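(* The function $\widetilde V:\mathbb{R}^n\times[0,T]\to\mathbb{R}$, $$\widetilde V(x,t)=\inf_{\tilde\gamma\in\widetilde\Gamma_{[t,T]}}\ \sup_{v(\cdot)\in\mathcal V_{[t,T]}}\ \max\Big\{\, l\big(\tilde\phi(T,t,x,\tilde\gamma[v](\cdot),v(\cdot))\big),\ \max_{\tau\in[t,T]} h\big(\tilde\phi(\tau,t,x,\tilde\gamma[v](\cdot),v(\cdot))\big)\Big\},$$ is the unique (continuous) viscosity solution over $\mathbb{R}^n\times[0,T]$ of the variational inequality $$\max\Big\{ h(x)-\widetilde V(x,t),\ \frac{\partial \widetilde V}{\partial t}(x,t)+\min\Big\{0,\ \sup_{v\in \mathbf V}\inf_{u\in U}\frac{\partial \widetilde V}{\partial x}(x,t)\, f(x,u,v)\Big\}\Big\}=0,$$ with terminal condition $\widetilde V(x,T)=\max\{l(x),h(x)\}$ for all $x\in\mathbb{R}^n$.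
   Context: Setting. $T\ge 0$ is a time horizon; $U\subseteq\mathbb{R}^m$ and $\mathbf V\subseteq\mathbb{R}^p$ are nonempty compact sets. $f:\mathbb{R}^n\times U\times \mathbf V\to\mathbb{R}^n$, $l:\mathbb{R}^n\to\mathbb{R}$ and $h:\mathbb{R}^n\to\mathbb{R}$ are bounded and Lipschitz continuous in $x$, and $f$ is continuous in $u$ and $v$; explicitly there are constants $C_f,C_l,C_h>0$ such that for all $x,\hat x\in\mathbb{R}^n$, $u\in U$, $v\in \mathbf V$: $|f(x,u,v)|\le C_f$, $|f(x,u,v)-f(\hat x,u,v)|\le C_f|x-\hat x|$, $|l(x)|\le C_l$, $|l(x)-l(\hat x)|\le C_l|x-\hat x|$, $|h(x)|\le C_h$, $|h(x)-h(\hat x)|\le C_h|x-\hat x|$. Augmented system. Let $\widetilde U=U\times[0,1]$, write $\tilde u=(u,\bar u)\in\widetilde U$, and set $\tilde f(x,\tilde u,v)=\bar u\, f(x,u,v)$. For $t\le t'$, $\widetilde{\mathcal U}_{[t,t']}$ and $\mathcal V_{[t,t']}$ denote the sets of Lebesgue measurable functions from $[t,t']$ to $\widetilde U$ and $\mathbf V$ respectively. For $t\in[0,T]$, $x\in\mathbb{R}^n$, $\tilde u(\cdot)\in\widetilde{\mathcal U}_{[t,T]}$, $v(\cdot)\in\mathcal V_{[t,T]}$, $\tilde\phi(\tau,t,x,\tilde u(\cdot),v(\cdot))$ for $\tau\in[t,T]$ denotes the value at time $\tau$ of the unique (absolutely continuous) solution of $\dot x(s)=\tilde f(x(s),\tilde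 u(s),v(s))$ a.e. with $x(t)=x$. $\widetilde\Gamma_{[t,T]}$ is the set of non-anticipative strategies for the augmented input: maps $\tilde\gamma:\mathcal V_{[t,T]}\to\widetilde{\mathcal U}_{[t,T]}$ such that for all $s\in[t,T]$ and $v,\hat v\in\mathcal V_{[t,T]}$, if $v(\tau)=\hat v(\tau)$ for a.e. $\tau\in[t,s]$ then $\tilde\gamma[v](\tau)=\tilde\gamma[\hat v](\tau)$ for a.e. $\tau\in[t,s]$. Viscosity solution. A continuous function $\widetilde V:\mathbb{R}^n\times[0,T]\to\mathbb{R}$ is a viscosity solution of the variational inequality with the given terminal condition if it satisfies the terminal condition and, for every $(x_0,t_0)\in\mathbb{R}^n\times(0,T)$ and every smooth $W:\mathbb{R}^n\times(0,T)\to\mathbb{R}$: (1) if $\widetilde V-W$ attains a local maximum at $(x_0,t_0)$, then $\max\{h(x_0)-\widetilde V(x_0,t_0),\ \frac{\partial W}{\partial t}(x_0,t_0)+\min\{0,\sup_{v\in \mathbf V}\inf_{u\in U}\frac{\partial W}{\partial x}(x_0,t_0)f(x_0,u,v)\}\}\ge 0$; (2) if $\widetilde V-W$ attains a local minimum at $(x_0,t_0)$, then the same expression is $\le 0$. *)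

(* Defs.v *)
From HB Require Import structures.
From mathcomp Require Import all_boot all_order all_algebra.
From mathcomp Require Import all_classical all_reals all_analysis.

Set Implicit Arguments.
Unset Strict Implicit.
Unset Printing Implicit Defensive.

Import Order.TTheory GRing.Theory Num.Theory.
Import numFieldNormedType.Exports.

Local Open Scope classical_set_scope.
Local Open Scope ring_scope.

(* The library norm `|x| of a row vector is the sup norm. *)
Definition enorm (R : realType) (n : nat) (x : 'rV[R]_n) : R :=
  Num.sqrt (\sum_i x 0 i ^+ 2).

Definition dot (R : realType) (n : nat) (p q : 'rV[R]_n) : R :=
  \sum_i p 0 i * q 0 i.

(* Lebesgue (not only Borel) measurability on the source: the source carries
   the sigma-algebra of completed_lebesgue_measure, the target its Borel
   sigma-algebra. *)
Definition lebesgue_measurable_fun (R : realType) (X : normedModType R)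
    (D : set R) (g : R -> X) : Prop :=
  measurable_fun (D : set (caratheodory_type (@wlength R idfun)^*%mu))
    (g : caratheodory_type (@wlength R idfun)^*%mu ->
         g_sigma_algebraType (@open X)).

Definition abs_continuous (R : realType) (E : normedModType R) (a b : R)
    (g : R -> E) : Prop :=
  forall e : R, 0 < e -> exists2 d : R, 0 < d &
    forall (k : nat) (c c' : 'I_k -> R),
      (forall i, a <= c i /\ c i <= c' i /\ c' i <= b) ->
      trivIset setT (fun i => [set` `]c i, c' i[]) ->
      \sum_i (c' i - c i) < d ->
      \sum_i `|g (c' i) - g (c i)| < e.

Section differential_game.
Context (R : realType) (n m p : nat).
Variables (U : set 'rV[R]_m) (V : set 'rV[R]_p).
Variable f : 'rV[R]_n -> 'rV[R]_m -> 'rV[R]_p -> 'rV[R]_n.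
Variables l h : 'rV[R]_n -> R.
Variable T : R.

(* A function on [a, b] is represented by a total function on R whose values
   outside [a, b] are never used. *)
Definition controls (X : normedModType R) (A : set X) (a b : R) :
    set (R -> X) :=
  [set c | (forall s, a <= s <= b -> A (c s)) /\
           lebesgue_measurable_fun [set` `[a, b]] c].

Definition aug_inputs : set ('rV[R]_m * R) := U `*` [set` `[0, 1]].

Definition aug_dyn (x : 'rV[R]_n) (w : 'rV[R]_m * R) (b : 'rV[R]_p) :
  'rV[R]_n := w.2 *: f x w.1 b.

Definition aug_trajectory (t : R) (x : 'rV[R]_n) (u : R -> 'rV[R]_m * R)
    (v : R -> 'rV[R]_p) : set (R -> 'rV[R]_n) :=
  [set phi | [/\ phi t = x, abs_continuous t T phi &
    {ae lebesgue_measure, forall s, t <= s <= T ->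
      is_derive s 1 phi (aug_dyn (phi s) (u s) (v s))}]].

(* Under the standing assumptions aug_trajectory t x u v is inhabited and its
   elements coincide on [t, T], so the choice is immaterial there. *)
Definition aug_flow (tau t : R) (x : 'rV[R]_n) (u : R -> 'rV[R]_m * R)
    (v : R -> 'rV[R]_p) : 'rV[R]_n :=
  xget (fun=> 0) (aug_trajectory t x u v) tau.

(* The strategies for total representatives: nonanticipation at s = T makes the
   output on [t, T], up to a null set, independent of the values of the
   argument outside [t, T]. *)
Definition aug_strategies (t : R) :
    set ((R -> 'rV[R]_p) -> (R -> 'rV[R]_m * R)) :=
  [set gamma |
    (forall v, controls V t T v -> controls aug_inputs t T (gamma v)) /\
    (forall s v v', t <= s <= T -> controls V t T v -> controls V t T v' ->
      {ae lebesgue_measure, forall tau, t <= tau <= s -> v tau = v' tau} ->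
      {ae lebesgue_measure, forall tau, t <= tau <= s ->
        gamma v tau = gamma v' tau})].

(* The inner sup is over a continuous image of the compact interval [t, T],
   hence is the maximum. *)
Definition payoff (t : R) (x : 'rV[R]_n) (u : R -> 'rV[R]_m * R)
    (v : R -> 'rV[R]_p) : R :=
  Num.max (l (aug_flow T t x u v))
          (sup [set h (aug_flow tau t x u v) | tau in [set` `[t, T]]]).

(* sup and inf are those of R; every set they are applied to is nonempty and
   bounded under the standing assumptions. *)
Definition value (z : 'rV[R]_n * R) : R :=
  inf [set sup [set payoff z.2 z.1 (gamma v) v | v in controls V z.2 T]
      | gamma in aug_strategies z.2].

Fixpoint iter_derive (ds : seq ('rV[R]_n * R)) (W : 'rV[R]_n * R -> R) :
    'rV[R]_n * R -> R :=
  if ds is d :: ds' then 'D_d (iter_derive ds' W) else W.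

(* C^infinity on an open set: all iterated directional derivatives exist and
   are continuous there. *)
Definition smooth_on (O : set ('rV[R]_n * R)) (W : 'rV[R]_n * R -> R) : Prop :=
  forall ds z, O z ->
    {for z, continuous (iter_derive ds W)} /\
    forall d, derivable (iter_derive ds W) z d.

Definition partial_t (W : 'rV[R]_n * R -> R) (z : 'rV[R]_n * R) : R :=
  'D_(0, 1) W z.

Definition partial_x (W : 'rV[R]_n * R -> R) (z : 'rV[R]_n * R) : 'rV[R]_n :=
  \row_i 'D_(delta_mx 0 i, 0) W z.

Definition hamiltonian (x q : 'rV[R]_n) : R :=
  sup [set inf [set dot q (f x u v) | u in U] | v in V].

Definition local_max (g : 'rV[R]_n * R -> R) (z0 : 'rV[R]_n * R) : Prop :=
  \forall z \near z0, g z <= g z0.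

Definition local_min (g : 'rV[R]_n * R -> R) (z0 : 'rV[R]_n * R) : Prop :=
  \forall z \near z0, g z0 <= g z.

(* The left-hand side of the variational inequality at z, with the derivatives
   of the unknown F replaced by those of the test function W. *)
Definition vi_expr (F W : 'rV[R]_n * R -> R) (z : 'rV[R]_n * R) : R :=
  Num.max (h z.1 - F z)
          (partial_t W z + Num.min 0 (hamiltonian z.1 (partial_x W z))).

(* Only the values of F on R^n x [0, T] matter. *)
Definition viscosity_solution (F : 'rV[R]_n * R -> R) : Prop :=
  [/\ {within [set z | 0 <= z.2 <= T], continuous F},
      forall x, F (x, T) = Num.max (l x) (h x) &
      forall (z0 : 'rV[R]_n * R) (W : 'rV[R]_n * R -> R),
        0 < z0.2 < T -> smooth_on [set z | 0 < z.2 < T] W ->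
        (local_max (F \- W) z0 -> 0 <= vi_expr F W z0) /\
        (local_min (F \- W) z0 -> vi_expr F W z0 <= 0)].

End differential_game.

(* Main.v *)
(* The set of admissible strategies is closed under concatenation, and along one
   trajectory only one continuation strategy is ever used, so the dynamic
   programming principle holds without any measurability in the intermediate
   state.  It makes the value Lipschitz and, combined with the first order
   expansion of a test function along a trajectory, yields both viscosity
   inequalities: a subsolution violation is contradicted by a feedback
   [v |-> sigma v] with countably many values, a supersolution violation by a
   constant control of the maximizer.

   For uniqueness, the Hamiltonian is Lipschitz in the momentum with constant the
   bound C on the speed, so information propagates at speed at most C and two
   solutions can be compared on a compact cylinder, with no growth condition.
   Variables are doubled and the difference is penalized by
   [kap * b ^ k + lam / t], where the paraboloid b is at most 1 at the centre, at
   least 2 on the lateral boundary, and decreases in time fast enough to make the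
   penalty a strict supersolution; a large k keeps the maximum off the lateral
   boundary, and the term lam / t keeps it off t = 0. *)

Require Import Defs.
From HB Require Import structures.
From mathcomp Require Import all_boot all_order all_algebra.
From mathcomp Require Import all_classical all_reals all_analysis.
From mathcomp Require Import ring lra.

Set Implicit Arguments.
Unset Strict Implicit.
Unset Printing Implicit Defensive.

Import Order.TTheory GRing.Theory Num.Theory.
Import numFieldNormedType.Exports.

Local Open Scope classical_set_scope.
Local Open Scope ring_scope.

(** * Absolutely continuous functions *)

(** The [min] with 0 comes from the scalar input in [0, 1]: it scales [f], so the minimizing player
    may slow the motion down or freeze it, and any state can be held at cost 0 in the momentum term.
    Controls are only measurable, so trajectories are differentiable only almost everywhere.
    Estimates on them avoid integrals: each comes from the fact that an absolutely continuous
    function with nonpositive derivative almost everywhere does not increase, applied after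
    subtracting an explicit primitive. Integration serves only to build the Picard iterates. In the
    comparison argument the obstacle [h] needs no penalty. If the obstacle term is the active one
    for the subsolution, then [F1 <= h] at one of the doubled points, while [h <= F2] always holds
    at the other; since [h] is Lipschitz and the points are close, this contradicts the supposed
    gap. The terminal condition excludes a maximum at time [T] in the same way, by uniform
    continuity. *)

Lemma abs_continuous_dom (R : realType) (E1 E2 E3 : normedModType R) (a b K : R)
    (g1 : R -> E1) (g2 : R -> E2) (g3 : R -> E3) :
  (forall s s', a <= s -> s <= s' -> s' <= b ->
    `|g3 s' - g3 s| <= K * (`|g1 s' - g1 s| + `|g2 s' - g2 s|)) ->
  abs_continuous a b g1 -> abs_continuous a b g2 -> abs_continuous a b g3.
Proof.
move=> dom ac1 ac2 e e0.
pose K' := `|K| + 1.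
have K'0 : 0 < K' by rewrite ltr_wpDl.
have e'0 : 0 < e / K' / 2 by rewrite !divr_gt0.
have [d1 d10 h1] := ac1 _ e'0.
have [d2 d20 h2] := ac2 _ e'0.
exists (Num.min d1 d2); first by rewrite lt_min d10.
move=> k c c' cc' tri; rewrite lt_min => /andP[/(h1 _ _ _ cc' tri) l1 /(h2 _ _ _ cc' tri) l2].
apply: (@le_lt_trans _ _ (K' * (\sum_i `|g1 (c' i) - g1 (c i)| +
    \sum_i `|g2 (c' i) - g2 (c i)|))).
  rewrite -big_split /= mulr_sumr; apply: ler_sum => i _.
  have [ac [cc cb]] := cc' i.
  apply: (le_trans (dom _ _ ac cc cb)); apply: ler_wpM2r; first by rewrite addr_ge0.
  by rewrite /K'; have := ler_norm K; lra.
rewrite mulrC -ltr_pdivlMr //; lra.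
Qed.

Lemma abs_continuous_id (R : realType) (a b : R) : abs_continuous a b (@id R).
Proof.
move=> e e0; exists e => // k c c' cc' _ lt.
rewrite (eq_bigr (fun i => c' i - c i)) // => i _.
by rewrite ger0_norm // subr_ge0; have [_ []] := cc' i.
Qed.

Lemma abs_continuous_lip (R : realType) (E : normedModType R) (a b K : R) (g : R -> E) :
  (forall s s', a <= s -> s <= s' -> s' <= b -> `|g s' - g s| <= K * (s' - s)) ->
  abs_continuous a b g.
Proof.
move=> lip; apply: (@abs_continuous_dom _ _ _ _ a b (`|K|) id id); last 2 first.
- exact: abs_continuous_id.
- exact: abs_continuous_id.
move=> s s' as_ ss' s'b; apply: (le_trans (lip _ _ as_ ss' s'b)).
rewrite (ger0_norm (_ : 0 <= s' - s)) ?subr_ge0 //.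
have : K * (s' - s) <= `|K| * (s' - s) by rewrite ler_wpM2r ?subr_ge0 // ler_norm.
have : 0 <= `|K| * (s' - s) by rewrite mulr_ge0 // subr_ge0.
lra.
Qed.

Lemma abs_continuousW (R : realType) (E : normedModType R) (a b a' b' : R) (g : R -> E) :
  a <= a' -> b' <= b -> abs_continuous a b g -> abs_continuous a' b' g.
Proof.
move=> aa bb ac e /ac [d d0 h]; exists d => // k c c' cc'; apply: h => i.
by have [? [? ?]] := cc' i; split; [lra|split; lra].
Qed.

Lemma sum_itv_length_le (R : realType) (O : set R) (k : nat) (c c' : 'I_k -> R) :
  open O -> (forall i, c i <= c' i /\ [set` `]c i, c' i[] `<=` O) ->
  trivIset setT (fun i => [set` `]c i, c' i[]) ->
  ((\sum_i (c' i - c i))%:E <= lebesgue_measure O)%E.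
Proof.
move=> oO cO tri.
rewrite -sumEFin.
have E i : true -> (c' i - c i)%:E = lebesgue_measure [set` `]c i, c' i[].
  have [cc _] := cO i; move=> _; rewrite lebesgue_measure_itv /= lte_fin.
  case: ifPn => [_|]; first by rewrite -EFinD.
  by rewrite -leNgt => cc'; congr _%:E; apply/eqP; rewrite subr_eq0 eq_le cc' cc.
rewrite (eq_bigr _ E) -measure_semi_additive_ord //=; last first.
  by apply: bigsetU_measurable.
apply: le_measure; rewrite ?inE.
- exact: bigsetU_measurable.
- exact: measurable_realfun.open_measurable.
- apply: (big_ind (fun S => S `<=` O)) => [//|A B AO BO|i _]; last exact: (cO i).2.
  by rewrite subUset.
Qed.

Lemma trivIset_pairwise_itv (R : realType) (L : seq (R * R)) :
  pairwise (fun q q' => q.2 <= q'.1) L ->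
  trivIset setT (fun i : 'I_(size L) => [set` `](nth 0 L i).1, (nth 0 L i).2[]).
Proof.
move=> /(pairwiseP 0) pw i j _ _ [x [/=]]; rewrite !in_itv /= => /andP[xi xi'] /andP[xj xj'].
apply/val_inj/eqP; case: ltngtP => // ij.
- by have := pw i j (ltn_ord i) (ltn_ord j) ij; lra.
- by have := pw j i (ltn_ord j) (ltn_ord i) ij; lra.
Qed.

(* Cousin-type argument: up to an arbitrarily small slope, g does not increase
   across a small neighbourhood of a point where g' <= 0; the other points lie in
   an open set G of small measure, and the list L collects the intervals inside G
   that have been crossed, whose total variation is small by absolute continuity. *)
Lemma abs_continuous_derive_le0 (R : realType) (a b : R) (g : R -> R) :
  a <= b -> abs_continuous a b g ->
  {ae lebesgue_measure, forall s : R, a <= s <= b -> exists2 d, is_derive s 1 g d & d <= 0} ->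
  g b <= g a.
Proof.
move=> ab acg [N [mN N0 Nbad]].
apply/ler_addgt0Pr => e e0.
(* Half of [e] pays for the slope [K] over the whole interval, the other half for the crossed
   intervals inside [G]; the [+ 1] covers [a = b]. *)
pose K := e / 2 / (b - a + 1).
have K0 : 0 < K by rewrite !divr_gt0 // ltr_wpDl // subr_ge0.
have Kba : K * (b - a) <= e / 2.
  rewrite /K mulrAC ler_pdivrMr ?ltr_wpDl ?subr_ge0 //.
  by rewrite ler_wpM2l ?divr_ge0 ?(ltW e0) // lerDl.
have [d d0 acd] := acg (e / 2) (divr_gt0 e0 (ltr0Sn _ 1)).
have [G [oG NG mG]] : exists G : set R, [/\ open G, N `<=` G & (lebesgue_measure G < d%:E)%E].
  have Noo : (lebesgue_measure N < +oo)%E by rewrite N0.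
  have [G [oG NG mG]] := lebesgue_regularity_outer mN Noo d0.
  exists G; split => //; apply: le_lt_trans mG.
  rewrite -[X in (lebesgue_measure X <= _)%E](setDUK NG).
  apply: (le_trans (measureU2 _ _ _)) => //=.
  - by apply: measurableD => //; exact: measurable_realfun.open_measurable.
  - by rewrite N0 add0e.
pose len (L : seq (R * R)) : R := \sum_(q <- L) `|g q.2 - g q.1|.
pose B := [set s | a <= s <= b /\ exists L : seq (R * R),
  [/\ forall q, q \in L -> [/\ a <= q.1, q.1 <= q.2, q.2 <= s & [set` `]q.1, q.2[] `<=` G],
      pairwise (fun q q' => q.2 <= q'.1) L &
      g s - g a <= K * (s - a) + len L]].
(* One end of the crossing must be [s], because only difference quotients based at [s] are
   controlled. The left version puts [sup B] in [B], the right version then pushes beyond it. *)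
have step s : a <= s <= b -> exists2 r, 0 < r & forall s1 s2, s - r < s1 -> s1 <= s ->
  s <= s2 ->
    s2 < s + r -> (s1 = s \/ s2 = s) -> s2 <= b -> B s1 -> B s2.
  move=> sab; have [sN|sN] := pselect (N s).
    have := oG _ (NG _ sN) => /nbhs_ballP [r /= r0 sr]; exists r =>
      // s1 s2 s1l s1s ss2 s2r _ s2b.
    move=> [s1ab [L [LG Lp gL]]]; split; first by lra.
    exists (rcons L (s1, s2)); split.
    - move=> q; rewrite mem_rcons inE => /orP[/eqP -> /=|/LG [? ? ? ?]]; split => //; try lra.
      move=> x /=; rewrite in_itv /= => /andP[x1 x2]; apply: sr; rewrite /ball /= ltr_norml;
        lra.
    - by rewrite pairwise_rcons Lp andbT; apply/allP => q /LG [].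
    - rewrite /len -cats1 big_cat big_seq1 /= -/(len L).
      have := ler_norm (g s2 - g s1).
      have : K * (s1 - a) <= K * (s2 - a) by rewrite ler_wpM2l ?(ltW K0) //; lra.
      by move: gL; lra.
  have [D [gD Dg] D0] : exists2 D, is_derive s 1 g D & D <= 0.
    by apply: contrapT => H; apply: sN; apply: Nbad => /= /(_ sab).
  have : (h^-1 *: (g (h *: 1 + s) - g s)) @[h --> 0^'] --> D.
    by rewrite -Dg; exact: gD.
  move=> /cvgrPdist_lt /(_ _ K0) [r /= r0 rD].
  have incr y : `|y - s| < r -> y != s -> (y - s)^-1 * (g y - g s) < K.
    move=> ysr ys; have := rD (y - s); rewrite /= sub0r normrN subr_eq0 => /(_ ysr ys).
    by rewrite /GRing.scale /= mulr1 subrK ltr_norml; move: D0; lra.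
  exists r => // s1 s2 s1l s1s ss2 s2r s12 s2b [s1ab [L [LG Lp gL]]]; split; first by lra.
  exists L; split => //.
    by move=> q /LG [? ? ? ?]; split => //; lra.
  have : g s2 - g s1 <= K * (s2 - s1).
    case: s12 => [e1|e2].
      have [->|ne] := eqVneq s2 s; first by rewrite -e1 !subrr mulr0.
      have lt : 0 < s2 - s by rewrite subr_gt0 lt_neqAle eq_sym ne.
      have := incr s2; rewrite ltr_norml ne e1 mulrC ltr_pdivrMr // => H.
      by apply/ltW/H => //; lra.
    have [->|ne] := eqVneq s1 s; first by rewrite -e2 !subrr mulr0.
    have lt : 0 < s - s1 by rewrite subr_gt0 lt_neqAle ne.
    have := incr s1; rewrite ltr_norml ne e2 mulrC -(opprB s s1) -(opprB (g s)) invrN mulrN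
      mulNr.
    rewrite opprK ltr_pdivrMr // => H.
    by apply/ltW/H => //; lra.
  have -> : s2 - a = (s1 - a) + (s2 - s1) by ring.
  by rewrite mulrDr; move: gL; lra.
have Ba : B a.
  split; first by rewrite lexx.
  by exists [::]; split => //; rewrite !subrr mulr0 /len big_nil addr0.
have Bub : ubound B b by move=> s [/andP[]].
have hB : has_sup B by split; [exists a|exists b].
have Bs : B (sup B).
  have sab : a <= sup B <= b.
    rewrite ge_sup ?andbT //; last by exists a.
    by apply: ub_le_sup => //; exists b.
  have [r r0 sr] := step _ sab.
  have [s1 Bs1 s1l] := sup_adherent r0 hB.
  apply: (sr s1) => //; try lra.
  - by apply: ub_le_sup => //; exists b.
have Bb : B b.
  have [sab _] := Bs.
  have [r r0 sr] := step _ sab.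
  have [->//|ne] := eqVneq b (sup B).
  pose s2 := Num.min b (sup B + r / 2).
  have s2s : sup B < s2 by rewrite /s2 lt_min; apply/andP; split;
    [rewrite lt_neqAle eq_sym ne; lra|lra].
  have s2r : s2 < sup B + r by rewrite /s2 gt_min; apply/orP; right; lra.
  have s2b : s2 <= b by rewrite /s2 ge_min lexx.
  have : B s2 by apply: (sr (sup B)) => //; [lra|exact: ltW|left].
  move=> /(ub_le_sup (ex_intro _ b Bub)) H; exfalso; lra.
have [_ [L [LG Lp gL]]] := Bb.
suff : len L < e / 2 by move: gL Kba; lra.
rewrite /len (big_nth 0) big_mkord.
apply: (acd _ (fun i => (nth 0 L i).1) (fun i => (nth 0 L i).2)).
- by move=> i; have [? ? ? ?] := LG _ (mem_nth 0 (ltn_ord i)).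
- exact: trivIset_pairwise_itv.
- rewrite -lte_fin; apply: le_lt_trans mG; apply: sum_itv_length_le => //.
    by move=> i; have [? ? ? ?] := LG _ (mem_nth 0 (ltn_ord i)).
  exact: trivIset_pairwise_itv.
Qed.

(** * Almost everywhere statements, coordinates and differential equations *)

Lemma aeS (R : realType) (P Q : R -> Prop) : (forall s, P s -> Q s) ->
  {ae lebesgue_measure, forall s : R, P s} -> {ae lebesgue_measure, forall s : R, Q s}.
Proof. by move=> PQ [N [mN N0 PN]]; exists N; split => // x /= nQ; apply: PN => /= /PQ. Qed.

Lemma ae_and (R : realType) (P Q : R -> Prop) :
  {ae lebesgue_measure, forall s : R, P s} -> {ae lebesgue_measure, forall s : R, Q s} ->
  {ae lebesgue_measure, forall s : R, P s /\ Q s}.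
Proof.
move=> aeP aeQ; have FF := ae_filter_ringOfSetsType (@lebesgue_measure R).
exact: (@filterI _ _ FF _ _ aeP aeQ).
Qed.

Lemma ae_all (R : realType) (P : R -> Prop) : (forall s, P s) -> {ae lebesgue_measure,
  forall s : R, P s}.
Proof. by move=> Ps; exists set0; split => // s /= /(_ (Ps s)). Qed.
Lemma ler_coord_norm (R : realType) (n : nat) (x : 'rV[R]_n) i : `|x 0 i| <= `|x|.
Proof. by rewrite [leRHS]/Num.Def.normr /= mx_normrE; exact: (le_bigmax _ _ (0, i)). Qed.

Lemma rV_norm_le (R : realType) (n : nat) (x : 'rV[R]_n) (c : R) :
  0 <= c -> (forall i, `|x 0 i| <= c) -> `|x| <= c.
Proof.
move=> c0 xc; rewrite [leLHS]/Num.Def.normr /= mx_normrE (bigmax_le _ c0) // => -[i j] _ /=.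
by rewrite ord1.
Qed.

Lemma is_derive_coord (R : realType) (n : nat) (phi : R -> 'rV[R]_n) (s : R) (d : 'rV[R]_n) i :
  is_derive s 1 phi d -> is_derive s 1 (fun r => phi r 0 i : R) (d 0 i).
Proof.
move=> [phid <-]; apply: DeriveDef; first exact/(derivable_mxP _ _ _).1.
by rewrite derive_mx // mxE.
Qed.

Lemma is_derive_rV (R : realType) (n : nat) (phi : R -> 'rV[R]_n) (s : R) (d : 'rV[R]_n) :
  (forall i, is_derive s 1 (fun r => phi r 0 i : R) (d 0 i)) -> is_derive s 1 phi d.
Proof.
move=> phid; have dphi : derivable phi s 1.
  by apply/derivable_mxP => i j; rewrite ord1; exact: (@ex_derive _ _ _ _ _ _ _ (phid j)).
apply: DeriveDef => //; rewrite derive_mx //; apply/rowP => j; rewrite mxE.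
exact: (@derive_val _ _ _ _ _ _ _ (phid j)).
Qed.

Lemma abs_continuous_derive_le (R : realType) (a b : R) (g W w : R -> R) :
  a <= b -> abs_continuous a b g -> abs_continuous a b W ->
  (forall s : R, is_derive s 1 W (w s)) ->
  {ae lebesgue_measure, forall s : R, a <= s <= b -> exists2 d, is_derive s 1 g d & d <= w s} ->
  g b - g a <= W b - W a.
Proof.
move=> ab acg acW dW dg.
suff : g b - W b <= g a - W a by lra.
apply: (@abs_continuous_derive_le0 _ a b (fun s => g s - W s)) => //.
- apply: (@abs_continuous_dom _ _ _ _ a b 1 g W) => // s s' _ _ _.
  by rewrite mul1r (_ : _ - _ = (g s' - g s) - (W s' - W s)) ?ler_normB //; ring.
- apply: aeS dg => s gs /gs [d gd dw]; exists (d - w s); last by rewrite subr_le0.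
  exact: is_deriveB.
Qed.

(** [F] depends on time alone: a right-hand side is first evaluated along a curve, so that Picard
    iterates and true solutions are both instances. *)
Definition solves (R : realType) (n : nat) (a b : R) (F phi : R -> 'rV[R]_n) : Prop :=
  abs_continuous a b phi /\
  {ae lebesgue_measure, forall s : R, a <= s <= b -> is_derive s 1 phi (F s)}.

Section solves.
Context {R : realType} {n : nat}.
Implicit Types F G phi psi : R -> 'rV[R]_n.

Lemma solvesW a b a' b' F phi : a <= a' -> b' <= b -> solves a b F phi -> solves a' b' F phi.
Proof.
move=> aa bb [ac d]; split; first exact: abs_continuousW ac.
by apply: aeS d => s h /andP[? ?]; apply: h; lra.
Qed.

(** In the sup norm it suffices to bound each coordinate of [phi - psi] with both signs, and each of
    these is a scalar function whose derivative is at most [w]. The condition [W a <= W b] covers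
    dimension 0, where there is no coordinate to argue with. *)
Lemma solves_dist_le a b F G phi psi (W w : R -> R) :
  a <= b -> solves a b F phi -> solves a b G psi ->
  abs_continuous a b W -> (forall s : R, is_derive s 1 W (w s)) ->
  {ae lebesgue_measure, forall s : R, a <= s <= b -> `|F s - G s| <= w s} ->
  W a <= W b ->
  `|phi b - psi b| <= `|phi a - psi a| + (W b - W a).
Proof.
move=> ab [acp dp] [acq dq] acW dW FG Wab.
apply: rV_norm_le => [|i]; first by rewrite addr_ge0 // subr_ge0.
rewrite !mxE.
have key (e : R) : e = 1 \/ e = -1 ->
    e * (phi b 0 i - psi b 0 i) - e * (phi a 0 i - psi a 0 i) <= W b - W a.
  move=> e1; have ne : `|e| <= 1 by case: e1 => ->; rewrite ?normrN normr1.
  apply: (@abs_continuous_derive_le _ a b (fun s => e * (phi s 0 i - psi s 0 i)) W w) => //.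
    apply: (@abs_continuous_dom _ _ _ _ a b 1 phi psi) => // s s' _ _ _.
    rewrite mul1r -mulrBr normrM.
    apply: (le_trans (ler_piMl _ ne)) => //.
    have := ler_coord_norm (phi s' - phi s) i; have := ler_coord_norm (psi s' - psi s) i.
    rewrite !mxE => h1 h2; apply: (le_trans _ (lerD h2 h1)).
    rewrite (_ : _ - _ - _ = (phi s' 0 i - phi s 0 i) - (psi s' 0 i - psi s 0 i)); last by ring.
    exact: ler_normB.
  apply: aeS (ae_and dp (ae_and dq FG)) => s [+ [+ +]] sab =>
    /(_ sab) ps /(_ sab) qs /(_ sab) FGs.
  exists (e * (F s 0 i - G s 0 i)).
    by apply: is_deriveZ; apply: is_deriveB; exact: is_derive_coord.
  apply: le_trans FGs; apply: (le_trans (ler_norm _)); rewrite normrM.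
  apply: (le_trans (ler_piMl _ ne)) => //.
  by have := ler_coord_norm (F s - G s) i; rewrite !mxE.
have := ler_coord_norm (phi a - psi a) i; rewrite !mxE ler_norml => /andP[p1 p2].
have := key _ (or_introl erefl); have := key _ (or_intror erefl).
by rewrite !mulN1r !mul1r ler_norml; lra.
Qed.

End solves.

(** * Weighted norms and the Gronwall estimate *)

Section exp_weight.
Context {R : realType}.
Variables (a b c K : R).

Lemma is_derive_exp_weight (s : R) :
  is_derive s 1 (fun s : R => c * expR (K * (s - a))) (c * (K * expR (K * (s - a)))).
Proof.
apply: is_deriveZ => /=.
have d1 : is_derive s 1 (fun s : R => K * (s - a)) K.
  have := @is_deriveZ R R R (fun r : R => r - a) K s 1 _
    (is_deriveB (is_derive_id s 1) (is_derive_cst a s 1)).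
  by rewrite subr0 /GRing.scale /= mulr1.
rewrite mulrC; exact: (@is_derive1_comp _ expR (fun s : R =>
  K * (s - a)) s _ _ (is_derive_expR _) d1).
Qed.

Lemma abs_continuous_exp_weight : 0 <= K -> 
  abs_continuous a b (fun s : R => c * expR (K * (s - a))).
Proof.
move=> K0; apply: (@abs_continuous_lip _ _ _ _ (`|c| * (K * expR (K * (b - a))))) =>
  s s' as_ ss' s'b.
rewrite -mulrBr normrM -mulrA; apply: ler_wpM2l => //.
rewrite ger0_norm; last by rewrite subr_ge0 ler_expR ler_wpM2l // lerB.
apply: (@le_trans _ _ (expR (K * (s' - a)) * (K * (s' - s)))).
  have -> : K * (s - a) = K * (s' - a) + - (K * (s' - s)) by ring.
  rewrite expRD -{1}[expR (K * (s' - a))]mulr1 -mulrBr; apply: ler_wpM2l; first exact: expR_ge0.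
  by have := expR_ge1Dx (- (K * (s' - s))); lra.
rewrite -mulrA mulrCA; apply: ler_wpM2l => //.
by apply: ler_wpM2r; [rewrite subr_ge0|rewrite ler_expR ler_wpM2l // lerD2r].
Qed.

End exp_weight.

Section gronwall.
Context {R : realType} {n : nat}.
Implicit Types F G phi psi : R -> 'rV[R]_n.

(* One Picard step contracts by a factor 1/2 the norm weighted by
   [s |-> expR (- 2 L (s - a))]. *)
Lemma solves_weighted_dist_le (a b L M : R) F G phi psi :
  0 < L -> 0 <= M -> solves a b F phi -> solves a b G psi ->
  {ae lebesgue_measure, forall s : R, a <= s <= b ->
    `|F s - G s| <= L * (M * expR (2 * L * (s - a)))} ->
  forall s, a <= s <= b ->
  `|phi s - psi s| <= `|phi a - psi a| + M / 2 * expR (2 * L * (s - a)).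
Proof.
move=> L0 M0 sF sG FG s /andP[as_ sb].
have L20 : 0 <= 2 * L by rewrite mulr_ge0 // ltW.
have W0 : M / 2 * expR (2 * L * (a - a)) <= M / 2 * expR (2 * L * (s - a)).
  by rewrite ler_wpM2l ?divr_ge0 // ler_expR ler_wpM2l // lerD2r.
have := @solves_dist_le R n a s F G phi psi (fun s => M / 2 * expR (2 * L * (s - a)))
  (fun s => M / 2 * (2 * L * expR (2 * L * (s - a)))) as_ (solvesW (lexx a) sb sF)
  (solvesW (lexx a) sb sG) (abs_continuous_exp_weight _ _ _ L20)
  (is_derive_exp_weight _ _ _) _ W0.
have E0 : 0 <= M / 2 * expR (2 * L * (a - a)) by rewrite mulr_ge0 ?divr_ge0 ?expR_ge0.
move=> H; apply: le_trans (H _) _; last by lra.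
apply: aeS FG => r FGr /andP[ar rs]; apply: (le_trans (FGr _)); first by lra.
by rewrite le_eqVlt; apply/orP; left; apply/eqP; field.
Qed.

(** Let [D] be the distances divided by the exponential weight. The contraction by 1/2 gives
    [sup D <= |phi a - psi a| + sup D / 2], and absorbing the last term produces the factor 2. The
    crude bound [B] only ensures that [sup D] is finite. *)
Lemma gronwall (a b L B : R) F G phi psi :
  0 < L -> solves a b F phi -> solves a b G psi ->
  {ae lebesgue_measure, forall s : R, a <= s <= b -> `|F s - G s| <= L * `|phi s - psi s|} ->
  (forall s, a <= s <= b -> `|phi s - psi s| <= B) ->
  forall s, a <= s <= b ->
  `|phi s - psi s| <= 2 * expR (2 * L * (b - a)) * `|phi a - psi a|.
Proof.
move=> L0 sF sG FG dB s sab.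
have E1 r : a <= r -> 1 <= expR (2 * L * (r - a)).
  by move=> ar; rewrite -expR0 ler_expR mulr_ge0 ?subr_ge0 // mulr_ge0 // ltW.
pose D := [set `|phi r - psi r| / expR (2 * L * (r - a)) | r in [set r | a <= r <= b]].
have hD : has_sup D.
  split; first by exists (`|phi s - psi s| / expR (2 * L * (s - a))), s.
  exists B => _ [r rab <-]; rewrite ler_pdivrMr ?expR_gt0 //.
  have /andP[ar _] := rab; have := E1 _ ar; have := dB _ rab => dr e1.
  by apply: (le_trans dr); rewrite ler_peMr // (le_trans _ dr).
have DM r : a <= r <= b -> `|phi r - psi r| <= sup D * expR (2 * L * (r - a)).
  move=> rab; rewrite -ler_pdivrMr ?expR_gt0 //.
  by apply: (ub_le_sup hD.2); exists r.
have M0 : 0 <= sup D.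
  have := DM _ sab => H; have := le_trans (normr_ge0 _) H.
  by rewrite pmulr_lge0 // expR_gt0.
have M2 : sup D <= 2 * `|phi a - psi a|.
  suff : sup D <= `|phi a - psi a| + sup D / 2 by lra.
  apply: ge_sup hD.1 _ => _ [r rab <-]; rewrite ler_pdivrMr ?expR_gt0 //.
  have /andP[ar _] := rab.
  apply: (le_trans (solves_weighted_dist_le L0 M0 sF sG _ rab)).
    apply: aeS FG => r' H r'ab; apply: (le_trans (H r'ab)); apply: ler_wpM2l; first exact: ltW.
    exact: DM.
  by rewrite [leRHS]mulrDl lerD // ler_peMr // E1.
apply: (le_trans (DM _ sab)).
rewrite [leRHS]mulrAC; apply: ler_pM => //; rewrite ?expR_ge0 //.
have /andP[_ sb] := sab.
by rewrite ler_expR ler_wpM2l ?lerD2r // mulr_ge0 // ltW.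
Qed.

(** The curve is compared with the one frozen at [phi s], which solves the equation with right-hand
    side 0. *)
Lemma solves_lip (a b C : R) F phi : 0 <= C -> solves a b F phi ->
  {ae lebesgue_measure, forall s : R, a <= s <= b -> `|F s| <= C} ->
  forall s s', a <= s -> s <= s' -> s' <= b -> `|phi s' - phi s| <= C * (s' - s).
Proof.
move=> C0 sF FC s s' as_ ss' s'b.
have s0 : solves a b (fun=> 0 : 'rV[R]_n) (fun=> phi s).
  split; last by apply: ae_all => r _; exact: is_derive_cst.
  apply: (@abs_continuous_lip _ _ _ _ 0) => *; by rewrite subrr normr0 mul0r.
have := @solves_dist_le R n s s' F _ phi _ (fun r => C * r) (fun=> C) ss'
  (solvesW as_ s'b sF) (solvesW as_ s'b s0).
rewrite subrr normr0 add0r -mulrBr; apply.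
- apply: (@abs_continuous_lip _ _ _ _ C) => r r' _ rr' _.
  by rewrite -mulrBr normrM !ger0_norm ?subr_ge0.
- move=> r; have := @is_deriveZ R R R id C r 1 _ (is_derive_id r 1).
  by rewrite /GRing.scale /= mulr1.
- by apply: aeS FC => r H rs; rewrite subr0; apply: H; lra.
- by rewrite ler_wpM2l.
Qed.

End gronwall.
(** * Lebesgue measurability and Caratheodory solutions *)

Definition lebesgue_set (R : realType) (A : set R) : Prop :=
  measurable (A : set (caratheodory_type (@wlength R idfun)^*%mu)).

Section lebesgue_set.
Context {R : realType}.
Implicit Types A B : set R.

Lemma lebesgue_setI A B : lebesgue_set A -> lebesgue_set B -> lebesgue_set (A `&` B).
Proof. exact: measurableI. Qed.

Lemma lebesgue_setU A B : lebesgue_set A -> lebesgue_set B -> lebesgue_set (A `|` B).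
Proof. exact: measurableU. Qed.

Lemma lebesgue_setD A B : lebesgue_set A -> lebesgue_set B -> lebesgue_set (A `\` B).
Proof. exact: measurableD. Qed.

Lemma lebesgue_set_bigcup (I : countType) (F : I -> set R) :
  (forall i, lebesgue_set (F i)) -> lebesgue_set (\bigcup_i F i).
Proof. exact: countable_bigcupT_measurable. Qed.

Lemma lebesgue_set_borel (A : set R) : measurable (A : set (measurableTypeR R)) ->
  lebesgue_set A.
Proof. exact: sub_caratheodory. Qed.

Lemma lebesgue_set_itv (i : interval R) : lebesgue_set [set` i].
Proof. by apply: lebesgue_set_borel; exact: measurable_itv. Qed.

Lemma lebesgue_set_decomp A : lebesgue_set A ->
  exists B N : set R, [/\ measurable (B : set (measurableTypeR R)),
    measurable (N : set (measurableTypeR R)), lebesgue_measure N = 0 &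
    B `<=` A /\ A `<=` B `|` N].
Proof.
rewrite /lebesgue_set -completed_caratheodory_measurable g_sigma_completed_algebra_genE.
move=> [B mB [M [N [mN N0 MN]] <-]]; exists B, N; split => //; split.
  by move=> x; left.
by apply: setUS.
Qed.

Lemma lebesgue_measurable_funP (X : normedModType R) (D : set R) (g : R -> X) :
  lebesgue_set D ->
  lebesgue_measurable_fun D g <-> forall G, open G -> lebesgue_set (D `&` g @^-1` G).
Proof.
move=> mD; split=> [mg G oG|mg _].
  by apply: mg => //; apply: sub_sigma_algebra.
suff : measurable_fun (D : set (caratheodory_type (@wlength R idfun)^*%mu))
    (g : caratheodory_type (@wlength R idfun)^*%mu -> g_sigma_algebraType (@open X)).
  exact.
by apply: measurability => //; move=> _ [G oG <-]; exact: mg.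
Qed.

End lebesgue_set.

Lemma negligible_bigcup_countable (R : realType) (I : countType) (F : I -> set R) :
  (forall i, lebesgue_measure.-negligible (F i)) ->
    lebesgue_measure.-negligible (\bigcup_i F i).
Proof.
move=> F0.
pose F' (k : nat) : set R := if unpickle k is Some q then F q else set0.
have [N [mN N0 MN]] : lebesgue_measure.-negligible (\bigcup_k F' k).
  apply: negligible_bigcup => k; rewrite /F'.
  by case: unpickle => [q //|]; exact: negligible_set0.
exists N; split => // x [q _ Bx]; apply: MN; exists (pickle q) => //.
by rewrite /F' pickleK.
Qed.
(* The integration library works with the Borel sigma-algebra, hence the passage to
   a Borel function equal almost everywhere. *)
Lemma borel_modification (R : realType) (a b : R) (g : R -> R) :
  (forall G, open G -> lebesgue_set ([set` `[a, b]] `&` g @^-1` G)) ->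
  exists g' : R -> R, [/\ measurable_fun [set: measurableTypeR R] g',
    {ae lebesgue_measure, forall s : R, a <= s <= b -> g' s = g s} &
    forall s, g' s = 0 \/ (a <= s <= b /\ g' s = g s)].
Proof.
move=> mg.
pose J : set (measurableTypeR R) := [set` `[a, b]].
have mJ : measurable J by exact: measurable_itv.
have /choice [BN BNP] : forall q : rat, exists BN : set R * set R,
  [/\ measurable (BN.1 : set (measurableTypeR R)),
    measurable (BN.2 : set (measurableTypeR R)), lebesgue_measure BN.2 = 0 &
    BN.1 `<=` [set` `[a, b]] `&` g @^-1` [set x | ratr q < x] /\
    [set` `[a, b]] `&` g @^-1` [set x | ratr q < x] `<=` BN.1 `|` BN.2].
  move=> q; have [B [N H]] := lebesgue_set_decomp (mg _ (@open_gt R (ratr q))).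
  by exists (B, N).
(* Each rational superlevel set is Borel up to a null set. Removing the countable union [M] of these
   null sets makes all of them Borel at once, and the value 0 off [S] preserves any bound on [g]. *)
pose M := \bigcup_q (BN q).2.
have mM : measurable (M : set (measurableTypeR R)).
  by apply: bigcupT_measurable_rat => q; have [] := BNP q.
have M0 : lebesgue_measure.-negligible M.
  apply: negligible_bigcup_countable => q; have [_ m2 n0 _] := BNP q.
  by exists (BN q).2; split.
pose S := J `\` M.
have mS : measurable S by exact: measurableD.
pose g' s := if s \in S then g s else 0.
exists g'; split.
- have mq (q : rat) : measurable ([set x | ratr q < g' x] : set (measurableTypeR R)).
    have [m1 _ _ [B1 B2]] := BNP q.
    have E : J `&` g @^-1` [set x | ratr q < x] `\` M = (BN q).1 `\` M.
      apply/seteqP; split=> x [h nM]; split => //; last exact: B1.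
      by have [//|Nx] := B2 _ h; case: nM; exists q.
    rewrite (_ : [set x | _] = (if 0 < (- ratr q : R) then ~` S else set0) `|` ((BN q).1 `\`
      M)).
      apply: measurableU; last exact: measurableD.
      by case: ifP => // _; exact: measurableC.
    rewrite -E; apply/seteqP; have g'E x := pselect (S x).
    split=> x /=; have [Sx|nS] := g'E x; rewrite /g' ?(mem_set Sx) ?(memNset nS).
    + by move=> qx; right; case: Sx.
    + by rewrite -oppr_gt0 => ->; left.
    + by case=> [|[[]//]]; case: ifP.
    + by rewrite oppr_gt0; case: ifP => // _ [//|[[Jx _] nM]]; case: nS.
  move=> _; apply: (measurability _ (measurable_realfun.RGenOInfty.measurableE R)) => //.
  move=> _ [_ [x ->] <-]; rewrite setTI.
  rewrite (_ : _ @^-1` _ = \bigcup_(q in [set: rat])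
      (if x <= ratr q then [set s | ratr q < g' s] else set0)).
    by apply: bigcupT_measurable_rat => q; case: ifP.
  apply/seteqP; split=> s /=.
    rewrite in_itv /= andbT => xs; have [q] := rat_in_itvoo xs.
    by rewrite in_itv /= => /andP[xq qs]; exists q => //=; rewrite (ltW xq).
  by move=> [q _]; case: ifP => // xq /= qs; rewrite in_itv /= andbT (le_lt_trans xq).
- case: M0 => N [mN N0 MN]; exists N; split => // s /= h; apply: MN; apply: contrapT => nM.
  apply: h => sab; rewrite /g' mem_set //; split => //=.
- move=> s; rewrite /g'; case: ifPn; last by left.
  by rewrite inE => -[Js _]; right; split => //; move: Js; rewrite /J /= in_itv.
Qed.

Lemma ae_neq (R : realType) (a : R) : {ae lebesgue_measure, forall s : R, s <> a}.
Proof.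
exists [set a]; split; [exact: measurable_set1|exact: lebesgue_measure_set1|].
by move=> s /= /contrapT.
Qed.

Lemma bounded_primitive (R : realType) (a b C : R) (g : R -> R) :
  0 <= C -> (forall G, open G -> lebesgue_set ([set` `[a, b]] `&` g @^-1` G)) ->
  (forall s, a <= s <= b -> `|g s| <= C) ->
  exists G : R -> R,
    [/\ G a = 0, forall s s', a <= s -> s <= s' -> s' <= b -> `|G s' - G s| <= C * (s' - s) &
     {ae lebesgue_measure, forall s : R, a <= s <= b -> is_derive s 1 G (g s)}].
Proof.
move=> C0 mg gC; have [g' [mg' gg' g'0]] := borel_modification mg.
have g'C s : `|g' s| <= C by case: (g'0 s) => [->|[sab ->]]; [rewrite normr0|exact: gC].
have ig (k : R -> R) (i j : R) (b1 b2 : bool) :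
    measurable_fun [set: measurableTypeR R] k -> (forall s, `|k s| <= C) ->
    lebesgue_measure.-integrable [set` Interval (BSide b1 i) (BSide b2 j)] (EFin \o k).
  move=> mk kC.
  apply: measurable_bounded_integrable => //.
  - suff : (@lebesgue_measure R [set` Interval (BSide b1 i) (BSide b2 j)] < +oo)%E by [].
    by rewrite lebesgue_measure_itv /=; case: ifP => _; rewrite -?EFinD ltry.
  - exact: measurable_funTS.
  - by exists C; split; [exact: num_real|move=> x /ltW Cx s _ /=; rewrite (le_trans _ Cx)].
have lg : locally_integrable setT g'.
  split => //; first exact: openT.
  move=> K _ cK; have /integrableP[] // : lebesgue_measure.-integrable K (EFin \o g').
  apply: measurable_bounded_integrable => //.
  - exact: measurable_realfun.compact_measurable.
  - exact: compact_finite_measure.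
  - exact: measurable_funTS.
  - by exists C; split; [exact: num_real|move=> x /ltW Cx s _ /=; rewrite (le_trans _ Cx)].
have ftc := @FTC1 R g' (BLeft a) (fun y => ig g' a y true false mg' g'C) lg.
exists (fun y => \int[lebesgue_measure]_(t in [set` `[a, y]]) g' t); split.
- by rewrite set_itv1 Rintegral_set1.
- move=> s s' as_ ss' s'b.
  rewrite Rintegral_itvB //; last exact: ig.
  apply: (le_trans (le_normr_Rintegral _ (ig _ _ _ _ _ mg' g'C))) => //.
  apply: (@le_trans _ _ (\int[lebesgue_measure]_(t in [set` `]s, s']]) C)).
    apply: le_Rintegral => //.
    + by apply: (ig (fun s => `|g' s|)) => [|?]; [exact: measurableT_comp|rewrite normr_id].
    + by apply: (ig (fun=> C)) => // ?; rewrite ger0_norm.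
  rewrite Rintegral_cst //= lebesgue_measure_itv /= lte_fin.
  case: ifPn => [lt|]; first by rewrite -EFinD.
  by rewrite mulr0 mulr_ge0 // subr_ge0.
(* The fundamental theorem speaks of points beyond the left end, so [a] itself is discarded as a
   null set. *)
- apply: aeS (ae_and ftc (ae_and gg' (ae_neq a))) => s [h1 [h2 /eqP sa]] sab;
  have /andP[as_ _] := sab.
  have [|d1 d2] := h1; first by rewrite lte_fin lt_neqAle eq_sym sa.
  by apply: DeriveDef => //; rewrite -derive1E d2 h2.
Qed.

(** * Measurability of pairs and compositions *)

Definition separable (R : realType) (X : normedModType R) : Prop :=
  exists q : nat -> X, forall x (e : R), 0 < e -> exists i, ball (q i) e x.

Lemma separable_R (R : realType) : separable R.
Proof.
exists (fun k => if unpickle k is Some q then ratr (q : rat) else 0) => x e e0.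
have [q] : exists q : rat, (ratr q : R) \in `]x - e, x + e[ by apply: rat_in_itvoo; lra.
rewrite in_itv /= => qx; exists (pickle q); rewrite pickleK /ball /= ltr_norml; lra.
Qed.

Lemma separable_rV (R : realType) (n : nat) : separable 'rV[R]_n.
Proof.
exists (fun k => if unpickle k is Some q then map_mx ratr (q : 'rV[rat]_n) else 0) => x e e0.
have /choice [q qx] i : exists q : rat, (ratr q : R) \in `]x 0 i - e, x 0 i + e[.
  by apply: rat_in_itvoo; lra.
exists (pickle (\row_i q i)); rewrite pickleK; split => // i j; rewrite ord1 !mxE.
by have := qx j; rewrite in_itv /= /ball /= ltr_norml; lra.
Qed.

Lemma separable_prod (R : realType) (X Y : normedModType R) :
  separable X -> separable Y -> separable (X * Y)%type.
Proof.
move=> [q qX] [q' qY].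
exists (fun k => if unpickle k is Some ij then (q ij.1, q' ij.2) else 0) => -[x y] e e0.
have [i qi] := qX x e e0; have [j qj] := qY y e e0.
by exists (pickle (i, j)); rewrite pickleK; split.
Qed.

Section measurability.
Context {R : realType}.
Implicit Types (X Y : normedModType R) (D : set R).

Lemma open_ballP X (G : set X) x : open G -> G x -> exists2 e : R, 0 < e & ball x e `<=` G.
Proof.
by move=> oG Gx; have /nbhs_ballP[e /= e0 eG] := open_nbhs_nbhs (conj oG Gx); exists e.
Qed.

(** By separability an open set of the product is a countable union of boxes with centres in the
    dense sequences and radii [k.+1%:R^-1]. Interiors of balls are used because the hypotheses speak
    of open sets. *)
Lemma lebesgue_set_pair X Y D (g : R -> X) (g' : R -> Y) :
  separable X -> separable Y ->
  (forall G, open G -> lebesgue_set (D `&` g @^-1` G)) ->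
  (forall G, open G -> lebesgue_set (D `&` g' @^-1` G)) ->
  forall G : set (X * Y), open G -> lebesgue_set (D `&` (fun s => (g s, g' s)) @^-1` G).
Proof.
move=> [q qX] [q' qY] mg mg' G oG.
pose P (t : nat * nat * nat) := ball (q t.1.1) t.2.+1%:R^-1 `*` ball (q' t.1.2) t.2.+1%:R^-1
  `<=` G.
pose S (t : nat * nat * nat) : set R := if `[< P t >] then
  (D `&` g @^-1` (ball (q t.1.1) t.2.+1%:R^-1)^°) `&`
  (D `&` g' @^-1` (ball (q' t.1.2) t.2.+1%:R^-1)^°) else set0.
have -> : D `&` (fun s => (g s, g' s)) @^-1` G = \bigcup_t S t.
  apply/seteqP; split=> [s [Ds /= Gs]|s [t _]]; last first.
    rewrite /S; case: asboolP => // Pt [[Ds gs] [_ gs']]; split => //.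
    by apply: Pt; split; apply: interior_subset.
  have [e e0 eG] := open_ballP oG Gs.
  have [k _ /(_ k (leqnn k)) /=] := near_infty_natSinv_lt (PosNum (divr_gt0 e0 (ltr0Sn R 1))).
  set d := k.+1%:R^-1 => de.
  have d0 : 0 < d by rewrite invr_gt0.
  have [i qi] := qX (g s) d d0; have [j qj] := qY (g' s) d d0.
  exists ((i, j), k) => //; rewrite /S; case: asboolP => [_|nP]; last first.
    case: nP => -[x y] [/= xi yj]; apply: eG; split => /=.
      apply: (@le_ball _ _ _ (d + d)); first by lra.
      by apply: ball_triangle xi; apply: ball_sym.
    apply: (@le_ball _ _ _ (d + d)); first by lra.
    by apply: ball_triangle yj; apply: ball_sym.
  by split; split => //=; rewrite /interior; apply: open_nbhs_nbhs; split=> //;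
    exact: ball_open.
apply: lebesgue_set_bigcup => t; rewrite /S; case: asboolP => _.
  by apply: lebesgue_setI; [apply: mg|apply: mg']; exact: open_interior.
by apply: lebesgue_set_borel; exact: measurable0.
Qed.

(** [F] is continuous only relative to [K], so the preimage of [G] need not be open. The interior of
    the set of points that lie outside [K] or are sent into [G] is open, and it has the same trace
    along [z], which stays in [K]. *)
Lemma lebesgue_set_comp X (K : set X) D (z : R -> X) (Y : normedModType R) (F : X -> Y) :
  (forall s, D s -> K (z s)) ->
  (forall x, K x -> forall e : R, 0 < e -> \forall y \near x, K y -> `|F y - F x| < e) ->
  (forall G, open G -> lebesgue_set (D `&` z @^-1` G)) ->
  forall G, open G -> lebesgue_set (D `&` (F \o z) @^-1` G).
Proof.
move=> DK cF mz G oG.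
rewrite (_ : D `&` _ = D `&` z @^-1` [set y | K y -> G (F y)]^°).
  by apply: mz; exact: open_interior.
apply/seteqP; split => s [Ds Gs]; split => //=; last first.
  by have /= := interior_subset Gs; apply; exact: DK.
have [e e0 eG] := open_ballP oG Gs.
rewrite /interior /=; have := cF _ (DK _ Ds) e e0.
apply: filterS => y yF Ky; apply: eG; rewrite -ball_normE /= distrC; exact: yF.
Qed.

End measurability.
Lemma ae_forall (R : realType) (I : countType) (P : I -> R -> Prop) :
  (forall i, {ae lebesgue_measure, forall s : R, P i s}) ->
  {ae lebesgue_measure, forall s : R, forall i, P i s}.
Proof.
move=> aeP; have [N [mN N0 MN]] := @negligible_bigcup_countable R I (fun i =>
  ~` [set s | P i s]) aeP.
by exists N; split => // s /= /existsNP [i h]; apply: MN; exists i.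
Qed.

Lemma le0_geometric (R : realType) (x c : R) : (forall k, x <= c * 2^-1 ^+ k) -> x <= 0.
Proof.
move=> xc; apply/ler_addgt0Pr => e e0; rewrite add0r.
have c0 : 0 < `|c| + 1 by rewrite ltr_wpDl.
have [k _ /(_ k (leqnn k)) /=] := near_infty_natSinv_expn_lt (PosNum (divr_gt0 e0 c0)).
rewrite div1r ltr_pdivlMr // -exprVn => ke; apply: (le_trans (xc k)); apply: le_trans (ltW ke).
rewrite mulrC; apply: ler_wpM2l; first by rewrite exprn_ge0 // invr_ge0.
by have := ler_norm c; lra.
Qed.

(** The intervals of centre [u k] and radius [2 * c * 2^-1 ^+ k] are nested; the limit is the
    supremum of their left ends. *)
Lemma geometric_limit (R : realType) (u : nat -> R) (c : R) :
  (forall k, `|u k.+1 - u k| <= c * 2^-1 ^+ k) ->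
  exists l, forall k, `|l - u k| <= 2 * c * 2^-1 ^+ k.
Proof.
move=> uc.
have up k j : u (k + j)%N - 2 * c * 2^-1 ^+ (k + j) >= u k - 2 * c * 2^-1 ^+ k /\
    u (k + j)%N + 2 * c * 2^-1 ^+ (k + j) <= u k + 2 * c * 2^-1 ^+ k.
  elim: j => [|j [h1 h2]]; first by rewrite addn0.
  rewrite addnS exprS; have := uc (k + j)%N; rewrite ler_norml => /andP[].
  move: h1 h2; set E := c * 2^-1 ^+ (k + j).
  rewrite (_ : 2 * c * (2^-1 * 2^-1 ^+ (k + j)) = E); last by rewrite /E; field.
  rewrite (_ : 2 * c * 2^-1 ^+ (k + j) = 2 * E); last by rewrite /E; ring.
  by split; lra.
have c0 k : 0 <= 2 * c * 2^-1 ^+ k.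
  rewrite -mulrA mulr_ge0 //; exact: le_trans (uc k).
pose W := [set u k - 2 * c * 2^-1 ^+ k | k in [set: nat]].
have Wub k : ubound W (u k + 2 * c * 2^-1 ^+ k).
  move=> _ [j _ <-]; have [h1 _] := up j k; have [_ h2] := up k j.
  apply: (le_trans h1); apply: le_trans h2; rewrite addnC.
  by have := c0 (k + j)%N; lra.
have hW : has_sup W by split; [exists (u 0 - 2 * c * 2^-1 ^+ 0),
  0|exists (u 0 + 2 * c * 2^-1 ^+ 0); exact: Wub].
exists (sup W) => k; rewrite ler_norml; apply/andP; split.
  by rewrite lerBrDr addrC; apply: ub_le_sup hW.2 _ _; exists k.
by rewrite lerBlDl; apply: ge_sup hW.1 (Wub k).
Qed.

(** * Existence of Caratheodory solutions by Picard iteration *)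

Section picard.
Context {R : realType} {n : nat}.
Variables (a b C L : R) (x : 'rV[R]_n) (F : R -> 'rV[R]_n -> 'rV[R]_n).

Let lip (phi : R -> 'rV[R]_n) :=
  forall s s', a <= s -> s <= s' -> s' <= b -> `|phi s' - phi s| <= C * (s' - s).

Hypotheses (ab : a <= b) (C0 : 0 <= C) (L0 : 0 < L).
Hypothesis F_bounded : forall s y, a <= s <= b -> `|F s y| <= C.
Hypothesis F_lipschitz : forall s y z, a <= s <= b -> `|F s y - F s z| <= L * `|y - z|.
Hypothesis F_measurable : forall phi, lip phi -> forall i (G : set R), open G ->
  lebesgue_set ([set` `[a, b]] `&` (fun s => F s (phi s) 0 i) @^-1` G).

Lemma picard_step phi : lip phi ->
  exists psi, [/\ psi a = x, lip psi & solves a b (fun s => F s (phi s)) psi].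
Proof.
move=> lphi.
have /choice [G GP] i : exists G : R -> R,
    [/\ G a = 0, forall s s', a <= s -> s <= s' -> s' <= b -> `|G s' - G s| <= C * (s' - s) &
     {ae lebesgue_measure, forall s : R, a <= s <= b -> is_derive s 1 G (F s (phi s) 0 i)}].
  apply: bounded_primitive => //; first exact: F_measurable.
  move=> s sab; exact: le_trans (ler_coord_norm _ _) (F_bounded _ sab).
have lpsi : lip (fun s => x + \row_i G i s).
  move=> s s' as_ ss' s'b; apply: rV_norm_le => [|i].
    by rewrite mulr_ge0 // subr_ge0.
  rewrite !mxE (_ : _ - _ = G i s' - G i s); last by ring.
  by have [_ + _] := GP i; exact.
exists (fun s => x + \row_i G i s); split => //.
- by apply/rowP => i; rewrite !mxE; have [-> _ _] := GP i; rewrite addr0.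
- split; first exact: abs_continuous_lip lpsi.
  have : {ae lebesgue_measure, forall s : R, forall i, a <= s <= b ->
    is_derive s 1 (G i) (F s (phi s) 0 i)}.
    by apply: ae_forall => i; have [] := GP i.
  apply: aeS => s h sab; apply: is_derive_rV => i.
  have := @is_deriveD R R R _ _ s 1 _ _ (is_derive_cst (x 0 i) s 1) (h i sab).
  rewrite add0r; congr (is_derive _ _ _ _).
  by apply/funext => r; rewrite !mxE.
Qed.

(** The iterates stay [C]-Lipschitz, the only curves along which [F] is assumed measurable, and
    consecutive ones differ by [2^-1 ^+ k] times a fixed weight. Their pointwise limit is therefore
    [C]-Lipschitz too, so [P] applies to it, and the same contraction shows that it is a fixed point
    on [[a, b]]. *)
Lemma caratheodory_existence :
  exists phi, [/\ phi a = x, lip phi & solves a b (fun s => F s (phi s)) phi].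
Proof.
have [P PP] : exists P : (R -> 'rV[R]_n) -> (R -> 'rV[R]_n), forall phi, lip phi ->
    [/\ P phi a = x, lip (P phi) & solves a b (fun s => F s (phi s)) (P phi)].
  have [|P PP] := @choice _ _ (fun phi psi => lip phi ->
    [/\ psi a = x, lip psi & solves a b (fun s => F s (phi s)) psi]).
    move=> phi; have [/picard_step [psi ?]|nl] := pselect (lip phi); first by exists psi.
    by exists phi.
  by exists P.
pose phi := fix phi k := if k is k'.+1 then P (phi k') else (fun=> x).
have lphi k : lip (phi k).
  elim: k => [|k IH]; last by have [] := PP _ IH.
  by move=> s s' *; rewrite /= subrr normr0 mulr_ge0 // subr_ge0.
have phia k : phi k a = x by case: k => [//|k]; have [] := PP _ (lphi k).
pose e s := expR (2 * L * (s - a)).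
have e0 s : 0 < e s by exact: expR_gt0.
have e1 s : a <= s -> 1 <= e s.
  by move=> as_; rewrite -expR0 ler_expR mulr_ge0 ?subr_ge0 // mulr_ge0 // ltW.
have p2 k : 0 <= 2^-1 ^+ k :> R by rewrite exprn_ge0 // invr_ge0.
(* The iteration starts from the constant curve, which the first iterate leaves by at most
   [C * (b - a)]. *)
pose M := C * (b - a).
have M0 : 0 <= M by rewrite mulr_ge0 // subr_ge0.
have dist k s : a <= s <= b -> `|phi k.+1 s - phi k s| <= M * 2^-1 ^+ k * e s.
  elim: k s => [|k IH] s sab.
    have /andP[as_ sb] := sab; rewrite expr0 mulr1.
    have := lphi 1 a s (lexx a) as_ sb; rewrite phia => h; apply: (le_trans h).
    rewrite /M -mulrA; apply: ler_wpM2l => //.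
    by apply: (@le_trans _ _ (b - a)); [lra|rewrite ler_peMr ?subr_ge0 ?e1].
  have [_ _ s1] := PP _ (lphi k.+1); have [_ _ s2] := PP _ (lphi k).
  have Mk0 : 0 <= M * 2^-1 ^+ k by exact: mulr_ge0 M0 (p2 k).
  have := @solves_weighted_dist_le R n a b L (M * 2^-1 ^+ k) _ _ _ _ L0 Mk0 s1 s2.
  rewrite -/(phi k.+2) -/(phi k.+1) !phia subrr normr0 => h.
  apply: (le_trans (h _ s sab)).
    apply: ae_all => r rab; apply: (le_trans (F_lipschitz _ _ rab)).
    by apply: ler_wpM2l; [exact: ltW|exact: IH].
  by rewrite add0r exprS le_eqVlt; apply/orP; left; apply/eqP; rewrite /e; field.
have /choice [lim limP] : forall s, exists l : 'rV[R]_n, a <= s <= b -> forall k,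
    `|l - phi k s| <= 2 * M * 2^-1 ^+ k * e s.
  move=> s; have [sab|nsab] := boolP (a <= s <= b); last by exists 0.
  have /choice [l lP] i : exists l : R, forall k,
    `|l - phi k s 0 i| <= 2 * (M * e s) * 2^-1 ^+ k.
    apply: (geometric_limit (u := fun k => phi k s 0 i)) => k.
    have := le_trans (ler_coord_norm _ i) (dist k s sab); rewrite !mxE.
    by rewrite mulrAC.
  exists (\row_i l i) => _ k; apply: rV_norm_le => [|i].
    exact: mulr_ge0 (mulr_ge0 (mulr_ge0 _ M0) (p2 k)) (ltW (e0 s)).
  by rewrite !mxE (_ : 2 * M * _ * _ = 2 * (M * e s) * 2^-1 ^+ k) //; ring.
have llim : lip lim.
  move=> s s' as_ ss' s'b; rewrite -subr_le0.
  have sab : a <= s <= b by lra.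
  have s'ab : a <= s' <= b by lra.
  apply: (@le0_geometric _ _ (2 * M * e s' + 2 * M * e s)) => k.
  have := limP s sab k; have := limP s' s'ab k; have := lphi k s s' as_ ss' s'b.
  have : `|lim s' - lim s| <= `|phi k s' - phi k s| + `|lim s' - phi k s'| + `|lim s - phi k s|.
    rewrite (_ : lim s' - lim s = (phi k s' - phi k s) + (lim s' - phi k s') - (lim s - phi k
      s)).
      by apply: (le_trans (ler_normB _ _)); rewrite lerD2r ler_normD.
    by apply/rowP => i; rewrite !mxE; ring.
  rewrite (_ : (_ + _) * 2^-1 ^+ k = 2 * M * 2^-1 ^+ k * e s' + 2 * M * 2^-1 ^+ k * e s);
    last by ring.
  by lra.
have [Pa lP sP] := PP _ llim.
have Plim s : a <= s <= b -> P lim s = lim s.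
  move=> sab; apply/eqP; rewrite -subr_eq0 -normr_le0.
  apply: (@le0_geometric _ _ (2 * M * e s)) => k.
  have [_ _ sk] := PP _ (lphi k).
  have Mk0 : 0 <= 2 * M * 2^-1 ^+ k by exact: mulr_ge0 (mulr_ge0 _ M0) (p2 k).
  have := @solves_weighted_dist_le R n a b L (2 * M * 2^-1 ^+ k) _ _ _ _ L0 Mk0 sP sk.
  rewrite -/(phi k.+1) Pa phia subrr normr0 => h.
  have {}h := h _ s sab.
  have h1 : `|P lim s - phi k.+1 s| <= 2 * M * 2^-1 ^+ k / 2 * e s.
    rewrite -[leRHS]add0r; apply: h; apply: ae_all => r rab;
      apply: (le_trans (F_lipschitz _ _ rab)).
    by apply: ler_wpM2l; [exact: ltW|exact: limP].
  have h2 := limP s sab k.+1.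
  have : `|P lim s - lim s| <= `|P lim s - phi k.+1 s| + `|lim s - phi k.+1 s|.
    rewrite (_ : P lim s - lim s = (P lim s - phi k.+1 s) - (lim s - phi k.+1 s)) ?ler_normB //.
    by apply/rowP => i; rewrite !mxE; ring.
  move: h1 h2; rewrite exprS (_ : 2 * M * (_ * _) * e s = 2 * M * 2^-1 ^+ k * e s / 2);
    last by field.
  rewrite (_ : 2 * M * _ / 2 * e s = 2 * M * 2^-1 ^+ k * e s / 2); last by field.
  by rewrite (_ : 2 * M * e s * _ = 2 * M * 2^-1 ^+ k * e s); [lra|ring].
(* The witness is [P lim] and not [lim]: the two agree only on [[a, b]], and [solves] is known for
   [P lim]. *)
exists (P lim); split => //.
split; first exact: abs_continuous_lip lP.
by have [_] := sP; apply: aeS => s h sab; rewrite (Plim s sab); exact: h.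
Qed.

End picard.
(** * Test functions *)

Section taylor.
Context {R : realType}.

Lemma is_derive_line (E : normedModType R) (g : E -> R) (z d : E) (s : R) :
  derivable g (z + s *: d) d ->
  is_derive s 1 (fun r : R => g (z + r *: d)) ('D_d g (z + s *: d)).
Proof.
move=> gd.
have E1 : (fun k : R => k^-1 *: (g (z + (k *: 1 + s) *: d) - g (z + s *: d))) =
    (fun k : R => k^-1 *: (g (k *: d + (z + s *: d)) - g (z + s *: d))).
  apply/funext => k; congr (_ *: (g _ - _)).
  by rewrite [X in X + s](mulr1 k) scalerDl addrCA.
by apply: DeriveDef; rewrite /derivable /derive E1.
Qed.

Lemma increment_line_le (E : normedModType R) (g : E -> R) (z d : E) (delta c e : R) :
  (forall s, `|s| <= `|delta| ->
    derivable g (z + s *: d) d /\ `|'D_d g (z + s *: d) - c| <= e) ->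
  `|g (z + delta *: d) - g z - c * delta| <= e * `|delta|.
Proof.
move=> H.
have mvt a b : a <= b -> (forall s, a <= s <= b -> `|s| <= `|delta|) ->
    `|g (z + b *: d) - g (z + a *: d) - c * (b - a)| <= e * (b - a).
  move=> ab sd.
  have D s : a <= s <= b -> is_derive s 1 (fun r : R => g (z + r *: d)) ('D_d g (z + s *: d)).
    by move=> /sd /H [Ds _]; exact: is_derive_line.
  have [||s] := @MVT_segment R (fun r : R => g (z + r *: d)) (fun s =>
    'D_d g (z + s *: d)) a b ab.
  - by move=> s; rewrite in_itv /= => /andP[as_ sb]; apply: D; lra.
  - apply: derivable_within_continuous => s; rewrite in_itv /= => sab.
    exact: (@ex_derive _ _ _ _ _ _ _ (D s sab)).
  - rewrite in_itv /= => sab ->; rewrite -mulrBl normrM (ger0_norm (_ : 0 <= b - a))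
    ?subr_ge0 //.
    by apply: ler_wpM2r; [rewrite subr_ge0|have [_] := H _ (sd _ sab)].
have [d0|d0] := leP 0 delta.
  have := mvt 0 delta d0; rewrite scale0r addr0 subr0 (ger0_norm d0); apply.
  by move=> s /andP[s0 sd]; rewrite ger0_norm.
have := mvt delta 0 (ltW d0); rewrite scale0r addr0 sub0r (ltr0_norm d0) => M.
rewrite -normrN [X in `|X|](_ : _ = g z - g (z + delta *: d) - c * - delta); last by ring.
by apply: M => s /andP[sd s0]; rewrite ler0_norm // lerN2.
Qed.

(** [smooth_on] provides only directional derivatives, so differentiability is rebuilt from the
    continuity of the partial ones: move in one coordinate at a time at time [t0], then in time,
    with the mean value theorem on each segment. *)
Lemma smooth_on_expansion (n : nat) (O : set ('rV[R]_n * R)) (g : 'rV[R]_n * R -> R)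
    (z0 : 'rV[R]_n * R) (e : R) :
  open O -> O z0 -> smooth_on O g -> 0 < e ->
  \forall z \near z0, `|g z - g z0 - (partial_t g z0 * (z.2 - z0.2) +
    dot (partial_x g z0) (z.1 - z0.1))| <= e * (`|z.2 - z0.2| + \sum_i `|z.1 0 i - z0.1 0 i|).
Proof.
move=> oO Oz0 smg e0.
have cD d : \forall z \near z0, `|'D_d g z - 'D_d g z0| <= e.
  have [cd _] := smg [:: d] z0 Oz0.
  have /cvgrPdist_le /(_ e e0) : 'D_d g z @[z --> z0] --> 'D_d g z0 by exact: cd.
  by apply: filterS => z; rewrite distrC.
have near1 : \forall z \near z0, O z /\ `|'D_(0, 1) g z - 'D_(0, 1) g z0| <= e /\
    forall i : 'I_n, `|'D_(delta_mx 0 i, 0) g z - 'D_(delta_mx 0 i, 0) g z0| <= e.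
  apply: filterI; first by apply: open_nbhs_nbhs.
  apply: filterI; first exact: cD.
  exact: (@filter_forall _ _ (fun i z => `|'D_(delta_mx 0 i, 0) g z - 'D_(delta_mx 0 i,
    0) g z0| <= e)
    (nbhs z0) _ (fun i => cD _)).
have /nbhs_ballP [r /= r0 rP] := near1.
apply/nbhs_ballP; exists r => // z [zx zt].
case: z0 Oz0 cD near1 rP zx zt => [x0 t0] Oz0 _ _ rP /= zx zt.
case: z zx zt => [x t] /= zx zt.
have xi i : `|x0 0 i - x 0 i| < r by have [_ /(_ 0 i)] := zx.
have tr : `|t0 - t| < r by [].
(* [y k] has the first [k] coordinates of [x] and the others of [x0], so the spatial increment
   telescopes and every corner stays in the ball. *)
pose y k : 'rV[R]_n := \row_i if (i < k)%N then x 0 i else x0 0 i.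
have step (i : 'I_n) : `|g (y i.+1, t0) - g (y i, t0) -
    partial_x g (x0, t0) 0 i * (x 0 i - x0 0 i)| <= e * `|x 0 i - x0 0 i|.
  have -> : (y i.+1, t0) = (y i, t0) + (x 0 i - x0 0 i) *: (delta_mx 0 i, 0 : R).
    congr (_, _) => /=; last by rewrite scaler0 addr0.
    apply/rowP => j; rewrite !mxE eqxx /= ltnS leq_eqVlt.
    have [->|ne] := eqVneq j i; first by rewrite eqxx ltnn mulr1 /=; ring.
    by rewrite (inj_eq val_inj) (negbTE ne) mulr0 addr0.
  rewrite mxE; apply: increment_line_le => s sd.
  have wr : ball (x0, t0) r ((y i, t0) + s *: (delta_mx 0 i, 0 : R)).
    split => /=; last by rewrite scaler0 addr0; exact: ballxx.
    split => // a j; rewrite ord1 !mxE eqxx /= /ball /=.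
    have [->|ne] := eqVneq j i.
      rewrite ltnn mulr1 opprD addNKr normrN; apply: le_lt_trans sd _; by rewrite distrC.
    rewrite mulr0 addr0; case: ifP => _; [exact: xi|by rewrite subrr normr0].
  have [Ow [_ Dw]] := rP _ wr; split => //.
  by have [_ +] := smg [::] _ Ow; exact.
have stept : `|g (x, t) - g (x, t0) - partial_t g (x0, t0) * (t - t0)| <= e * `|t - t0|.
  have -> : (x, t) = (x, t0) + (t - t0) *: (0 : 'rV[R]_n, 1 : R).
    by congr (_, _) => /=; rewrite ?scaler0 ?addr0 // /GRing.scale /= mulr1; ring.
  apply: increment_line_le => s sd.
  have wr : ball (x0, t0) r ((x, t0) + s *: (0 : 'rV[R]_n, 1 : R)).
    split => /=; first by rewrite scaler0 addr0.
    rewrite /ball /= /GRing.scale /= mulr1 opprD addNKr normrN.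
    by apply: le_lt_trans sd _; rewrite distrC.
  have [Ow [Dw _]] := rP _ wr; split => //.
  by have [_ +] := smg [::] _ Ow; exact.
have y0 : y 0 = x0 by apply/rowP => i; rewrite mxE.
have yn : y n = x by apply/rowP => i; rewrite mxE ltn_ord.
have tele : g (x, t0) - g (x0, t0) = \sum_(i < n) (g (y i.+1, t0) - g (y i, t0)).
  by have := telescope_sumr (fun k => g (y k, t0)) (leq0n n); rewrite big_mkord y0 yn => ->.
rewrite (_ : _ - _ = (g (x, t) - g (x, t0) - partial_t g (x0, t0) * (t - t0)) +
  \sum_(i < n) (g (y i.+1, t0) - g (y i, t0) - partial_x g (x0, t0) 0 i * (x 0 i - x0 0 i))).
  apply: (le_trans (ler_normD _ _)); rewrite [leRHS]mulrDr; apply: lerD => //.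
  apply: (le_trans (ler_norm_sum _ _ _)); rewrite mulr_sumr; apply: ler_sum => i _; exact: step.
have dotE : dot (partial_x g (x0, t0)) (x - x0) =
    \sum_(i < n) partial_x g (x0, t0) 0 i * (x 0 i - x0 0 i).
  by apply: eq_bigr => i _; rewrite [(x - x0) 0 i]mxE [(- x0) 0 i]mxE.
by rewrite big_split /= -tele sumrN dotE; ring.
Qed.

End taylor.
(* [sigma v] only depends on the first set of a countable base that contains v and
   on which one element of A is good. *)
Lemma measurable_selection (R : realType) (X Y : normedModType R) (V : set X) (A : set Y)
    (good : Y -> X -> Prop) : separable X -> A !=set0 ->
  (forall v, V v -> exists2 w, A w & \forall v' \near v, V v' -> good w v') ->
  exists sigma : X -> Y, (forall v, V v -> A (sigma v) /\ good (sigma v) v) /\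
    forall a b c, controls V a b c -> controls A a b (sigma \o c).
Proof.
move=> [q qX] [w0 Aw0] Vgood.
pose N (ik : nat * nat) : set X := (ball (q ik.1) ik.2.+1%:R^-1)°.
have /choice [w wP] : forall j : nat, exists w : Y, A w /\
    forall ik, unpickle j = Some ik -> (exists2 w', A w' & forall v, V v -> N ik v ->
      good w' v) ->
      forall v, V v -> N ik v -> good w v.
  move=> j; case: (unpickle j) => [ik|]; last by exists w0.
  have [[w' Aw' gw']|nw] := pselect (exists2 w', A w' & forall v, V v -> N ik v -> good w' v).
    by exists w'; split => // _ [<-] _.
  by exists w0; split => // _ [<-] /nw.
pose D (j : nat) : set X := if unpickle j is Some ik then
  (if `[< exists2 w', A w' & forall v, V v -> N ik v ->
    good w' v >] then N ik else set0) else set0.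
have oD j : open (D j).
  rewrite /D; case: (unpickle j) => [ik|]; last exact: open0.
  by case: asboolP => _; [exact: open_interior|exact: open0].
have Dgood j v : V v -> D j v -> good (w j) v.
  rewrite /D; case E : (unpickle j) => [ik|] //; case: asboolP => // gw Vv Nv.
  exact: (wP j).2 ik E gw v Vv Nv.
have cover v : V v -> exists j, D j v.
  move=> Vv; have [w' Aw' /nbhs_ballP [e /= e0 eP]] := Vgood v Vv.
  have [k _ /(_ k (leqnn k)) /=] := near_infty_natSinv_lt (PosNum (divr_gt0 e0 (ltr0Sn R 1))).
  set d := k.+1%:R^-1 => de.
  have d0 : 0 < d by rewrite invr_gt0.
  have [i qi] := qX v d d0; exists (pickle (i, k)); rewrite /D pickleK.
  case: asboolP => [_|[]]; last first.
    exists w' => // v' Vv' /interior_subset /= qv'; apply: eP => //.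
    apply: (@le_ball _ _ _ (d + d)); first by lra.
    by apply: ball_triangle qv'; apply: ball_sym.
  by rewrite /N /interior /=; apply: open_nbhs_nbhs; split => //; exact: ball_open.
have exb v (h : exists j, D j v) : exists j, `[< D j v >].
  by have [j Dj] := h; exists j; apply/asboolP.
pose sigma v := if pselect (exists j, D j v) is left h then w (ex_minn (exb v h)) else w0.
exists sigma; split.
  move=> v Vv; rewrite /sigma; case: pselect => [h|[]]; last exact: cover.
  by case: ex_minnP => j /asboolP Dj _; split; [have [] := wP j|exact: Dgood].
move=> a b c [Vc mc]; split.
  by move=> s sab; rewrite /= /sigma; case: pselect => // h;
    have [] := wP (ex_minn (exb (c s) h)).
have {}mc := (lebesgue_measurable_funP c (lebesgue_set_itv `[a, b])).1 mc.
apply/lebesgue_measurable_funP => [|G oG]; first exact: lebesgue_set_itv.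
pose F j : set R := [set` `[a, b]] `&` c @^-1` (D j).
(* [E j] collects the times at which [j] is the first index whose [D j] contains [c s], provided
   that the value [w j] taken there lies in [G]. *)
pose E j : set R := if `[< G (w j) >] then F j `\` \bigcup_i (if (i < j)%N then F i else
  set0) else set0.
rewrite (_ : _ `&` _ = \bigcup_j E j).
  apply: lebesgue_set_bigcup => j; rewrite /E; case: asboolP => _;
    last exact: lebesgue_set_borel measurable0.
  apply: lebesgue_setD; first exact: mc.
  apply: lebesgue_set_bigcup => i; case: ifP => _;
    [exact: mc|exact: lebesgue_set_borel measurable0].
have sigmaE j s : F j s -> ~ (\bigcup_i (if (i < j)%N then F i else set0)) s ->
  sigma (c s) = w j.
  move=> [sab Dj] nF; rewrite /sigma; case: pselect => [h|[]]; last by exists j.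
  case: ex_minnP => i /asboolP Di min; congr w; apply/eqP; rewrite eqn_leq min ?andTb;
    last exact/asboolP.
  by rewrite leqNgt; apply/negP => ij; apply: nF; exists i; rewrite ?ij.
apply/seteqP; split=> s.
  move=> [sab Gs]; have h := cover _ (Vc s sab).
  pose j := ex_minn (exb _ h); have [Fj nF] : F j s /\ ~ (\bigcup_i (if (i < j)%N then F i
    else set0)) s.
    rewrite /j; case: ex_minnP => k /asboolP Dk min; split => //.
    move=> [i _]; case: ifP => // ik [_ Di]; have := min i (asboolT Di).
    by rewrite leqNgt ik.
  exists j => //; rewrite /E; case: asboolP => // -[]; rewrite -(sigmaE j s) //.
move=> [j _]; rewrite /E; case: asboolP => // Gj [Fj nF]; split; first by case: Fj.
by rewrite /= (sigmaE j s).
Qed.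

(** * Penalties built from coordinates, time and inverse time *)

Section test_functions.
Context {R : realType} {n : nat}.
Local Notation E := ('rV[R]_n * R)%type.
Implicit Types (g : E -> R) (z d : E).

(* Any class of functions closed under directional derivatives consists of smooth
   functions; this one contains all the penalties of the comparison argument. *)
Inductive rational_fun : (E -> R) -> Prop :=
| rational_cst c : rational_fun (fun=> c)
| rational_coord i : rational_fun (fun z => z.1 0 i)
| rational_time : rational_fun (fun z => z.2)
| rational_inv_time : rational_fun (fun z => z.2^-1)
| rational_add g g' : rational_fun g -> rational_fun g' -> rational_fun (fun z => g z + g' z)
| rational_mul g g' : rational_fun g -> rational_fun g' -> rational_fun (fun z => g z * g' z).

Lemma is_derive_coordinate z d i : is_derive z d (fun w : E => w.1 0 i : R) (d.1 0 i).
Proof.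
have cv : (fun k : R => k^-1 *: ((k *: d + z).1 0 i - z.1 0 i)) @ 0^' --> d.1 0 i.
  apply: cvg_near_cst; near=> k; rewrite !mxE addrK /GRing.scale /= mulKf //.
  by near: k; exact: nbhs_dnbhs_neq.
apply: DeriveDef; first by apply/cvg_ex; exists (d.1 0 i).
by apply: cvg_lim => //; exact: Rhausdorff.
Unshelve. all: by end_near. Qed.

Lemma is_derive_time z d : is_derive z d (fun w : E => w.2 : R) d.2.
Proof.
have cv : (fun k : R => k^-1 *: ((k *: d + z).2 - z.2)) @ 0^' --> d.2.
  apply: cvg_near_cst; near=> k; rewrite /= addrK /GRing.scale /= mulKf //.
  by near: k; exact: nbhs_dnbhs_neq.
apply: DeriveDef; first by apply/cvg_ex; exists d.2.
by apply: cvg_lim => //; exact: Rhausdorff.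
Unshelve. all: by end_near. Qed.

Lemma is_derive_inv_time z d : z.2 != 0 ->
  is_derive z d (fun w : E => (w.2)^-1 : R) (- z.2 ^- 2 * d.2).
Proof.
move=> z0; have [dt Dt] := is_derive_time z d.
apply: DeriveDef; first exact: (derivableV z0 dt).
by rewrite (deriveV z0 dt) Dt.
Qed.

Lemma rational_fun_derive g : rational_fun g -> forall d, exists2 g', rational_fun g' &
  forall z, 0 < z.2 -> is_derive z d g (g' z).
Proof.
elim=> [c|i|||f g' _ IHf _ IHg|f g' rf IHf rg IHg] d.
- by exists (fun=> 0); [exact: rational_cst|move=> z _; exact: is_derive_cst].
- by exists (fun=> d.1 0 i); [exact: rational_cst|move=> z _; exact: is_derive_coordinate].
- by exists (fun=> d.2); [exact: rational_cst|move=> z _; exact: is_derive_time].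
- exists (fun z => (- d.2) * (z.2^-1 * z.2^-1)).
    by apply: rational_mul; [exact: rational_cst|apply: rational_mul; exact: rational_inv_time].
  move=> z z0; have := is_derive_inv_time d (lt0r_neq0 z0).
  by congr (is_derive _ _ _ _); rewrite expr2 invfM; ring.
- have [f1 rf1 Df] := IHf d; have [g1 rg1 Dg] := IHg d.
  exists (fun z => f1 z + g1 z); first exact: rational_add.
  by move=> z z0; apply: is_deriveD; [exact: Df|exact: Dg].
- have [f1 rf1 Df] := IHf d; have [g1 rg1 Dg] := IHg d.
  exists (fun z => f z * g1 z + g' z * f1 z); first by apply: rational_add; exact: rational_mul.
  by move=> z z0; have := is_deriveM (Df z z0) (Dg z z0).
Qed.

Lemma rational_fun_continuous g : rational_fun g -> forall z, 0 < z.2 -> {for z, continuous g}.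
Proof.
elim=> [c|i|||f g' _ IHf _ IHg|f g' _ IHf _ IHg] z z0.
- exact: cvg_cst.
- apply: (@continuous_comp _ _ _ fst (fun x : 'rV[R]_n => x 0 i)); first exact: cvg_fst.
  exact: coord_continuous.
- exact: cvg_snd.
- by apply: cvgV; [exact: lt0r_neq0|exact: cvg_snd].
- by apply: cvgD; [exact: IHf|exact: IHg].
- by apply: cvgM; [exact: IHf|exact: IHg].
Qed.

(** An iterated derivative is identified with a member of the class only where [0 < z.2]. This set
    is open, so the identification is local and survives one more derivative. *)
Lemma rational_fun_smooth (T : R) g : rational_fun g -> smooth_on [set z | 0 < z.2 < T] g.
Proof.
move=> rg.
have oO : open [set z : E | 0 < z.2].
  rewrite (_ : mkset _ = snd @^-1` [set` `]0, +oo[]).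
    by apply: open_comp; [move=> z _; exact: cvg_snd|exact: interval_open].
  by apply/seteqP; split => z /=; rewrite in_itv /= andbT.
have near_eq (f1 f2 : E -> R) z : 0 < z.2 -> (forall w, 0 < w.2 -> f1 w = f2 w) ->
    \forall w \near z, f1 w = f2 w.
  move=> z0 e; have : nbhs z [set z : E | 0 < z.2] by exact: open_nbhs_nbhs.
  by apply: filterS => w; exact: e.
have key ds : exists2 g', rational_fun g' & forall z, 0 < z.2 -> iter_derive ds g z = g' z.
  elim: ds => [|d ds [g' rg' e]]; first by exists g.
  have [g1 rg1 D] := rational_fun_derive rg' d; exists g1 => // z z0 /=.
  by rewrite (near_eq_derive d (near_eq _ _ z z0 e)); have [_ ->] := D z z0.
move=> ds z /= /andP[z0 _]; have [g' rg' e] := key ds.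
have ne := near_eq _ _ z z0 e; split.
  suff : iter_derive ds g w @[w --> z] --> g' z by rewrite -(e z z0).
  apply: cvg_trans (rational_fun_continuous rg' z0).
  by apply: near_eq_cvg; apply: filterS ne => w ->.
move=> d; have [g1 _ D] := rational_fun_derive rg' d.
apply: (@near_eq_derivable _ _ _ g'); first by apply: filterS ne => w ->.
by have [] := D z z0.
Qed.

Lemma rational_sum (I : Type) (r : seq I) (F : I -> E -> R) :
  (forall i, rational_fun (F i)) -> rational_fun (fun z => \sum_(i <- r) F i z).
Proof.
move=> rF; elim: r => [|i r IH].
  by rewrite (_ : (fun _ => _) = fun=> 0); [exact: rational_cst|apply/funext => z;
    rewrite big_nil].
rewrite (_ : (fun _ => _) = fun z => F i z + \sum_(j <- r) F j z); first exact: rational_add.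
by apply/funext => z; rewrite big_cons.
Qed.

Lemma rational_exp g k : rational_fun g -> rational_fun (fun z => g z ^+ k).
Proof.
move=> rg; elim: k => [|k IH]; first exact: rational_cst.
rewrite (_ : (fun _ => _) = fun z => g z * g z ^+ k); first exact: rational_mul.
by apply/funext => z; rewrite exprS.
Qed.

(** Euclidean in space and time, hence polynomial and a legitimate test function, unlike the sup
    norm. *)
Definition sqdist (c z : E) : R := \sum_i (z.1 0 i - c.1 0 i) ^+ 2 + (z.2 - c.2) ^+ 2.

Lemma rational_sqdist c : rational_fun (sqdist c).
Proof.
have rB (g : E -> R) (a : R) : rational_fun g -> rational_fun (fun z => (g z - a) ^+ 2).
  by move=> rg; apply: rational_exp; apply: rational_add => //; exact: rational_cst.
apply: rational_add; last by apply: rB; exact: rational_time.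
by apply: rational_sum => i; apply: rB; exact: rational_coord.
Qed.

Lemma is_derive_sum_sq (c : 'rV[R]_n) z d : is_derive z d (fun w : E =>
  \sum_i (w.1 0 i - c 0 i) ^+ 2)
  (2 * \sum_i (z.1 0 i - c 0 i) * d.1 0 i).
Proof.
have D i : is_derive z d (fun w : E =>
  (w.1 0 i - c 0 i) ^+ 2 : R) (2 * ((z.1 0 i - c 0 i) * d.1 0 i)).
  have D1 := is_deriveB (is_derive_coordinate z d i) (is_derive_cst (c 0 i) z d).
  have := is_deriveX 2 D1; congr (is_derive _ _ _ _).
  by rewrite subr0 expr1; exact: (esym (mulrA 2 (z.1 0 i - c 0 i) (d.1 0 i))).
have := is_derive_sum D; rewrite mulr_sumr; congr (is_derive _ _ _ _).
by apply/funext => w; rewrite fct_sumE.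
Qed.

Lemma is_derive_sqdist c z d : is_derive z d (sqdist c)
  (2 * (\sum_i (z.1 0 i - c.1 0 i) * d.1 0 i + (z.2 - c.2) * d.2)).
Proof.
have D1 := is_deriveB (is_derive_time z d) (is_derive_cst c.2 z d).
have := is_deriveD (is_derive_sum_sq c.1 z d) (is_deriveX 2 D1); congr (is_derive _ _ _ _).
rewrite [RHS]mulrDr subr0 expr1; congr (_ + _).
exact: (esym (mulrA 2 (z.2 - c.2) d.2)).
Qed.

End test_functions.
Lemma within_continuous_near (R : realType) (X : normedModType R) (S : set X) (F : X ->
  R) z (e : R) :
  {within S, continuous F} -> S z -> 0 < e -> \forall z' \near z, S z' -> `|F z - F z'| < e.
Proof.
move=> /subspace_continuousP /(_ z) cF Sz e0; have /cvgrPdist_lt /(_ e e0) := cF Sz.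
by rewrite near_withinE.
Qed.

Lemma compact_uniformly_continuous (R : realType) (X : normedModType R) (Q S : set X) (F : X
  -> R) (e : R) :
  compact Q -> Q `<=` S -> {within S, continuous F} -> 0 < e ->
  exists2 d : R, 0 < d & forall z w, Q z -> Q w -> ball z d w -> `|F z - F w| < e.
Proof.
move=> /compact_near_coveringP cQ QS cF e0.
have e20 : 0 < e / 2 by rewrite divr_gt0.
pose P (d : R) z := Q z -> forall w, Q w -> ball z d w -> `|F z - F w| < e.
have ex0 : \forall d \near (0 : R)^'+, 0 < d by exact: nbhs_right_gt.
suff near z : Q z -> \forall z' \near z & d \near (0 : R)^'+, P d z'.
  have QP : \forall d \near (0 : R)^'+, Q `<=` P d by exact: cQ near.
  have [d [d0 dP]] := filter_ex (filterI ex0 QP).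
  by exists d => // z' w Qz' Qw; exact: dP.
move=> Qz.
have /nbhs_ballP [r /= r0 rP] := within_continuous_near cF (QS _ Qz) e20.
exists (ball z (r / 2), [set d : R | d < r / 2]).
  split; first by apply: nbhsx_ballx; rewrite divr_gt0.
  by apply: nbhs_right_lt; rewrite divr_gt0.
move=> [z' d] [/= zz' dr] Qz' w Qw z'w.
have h1 : `|F z - F z'| < e / 2 by apply: rP (QS _ Qz'); apply: le_ball zz'; lra.
have h2 : `|F z - F w| < e / 2.
  apply: rP (QS _ Qw); rewrite (splitr r); apply: ball_triangle zz' _.
  by apply: le_ball z'w; exact: ltW.
have := ler_distD (F z) (F z') (F w); rewrite (distrC (F z') (F z)); lra.
Qed.
(** * Comparison principle *)

Section dot.
Context {R : realType} {n : nat}.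

Lemma dotBr (q y z : 'rV[R]_n) : dot q (y - z) = dot q y - dot q z.
Proof. by rewrite /dot -sumrB; apply: eq_bigr => i _; rewrite !mxE mulrBr. Qed.

Lemma dotNl (q y : 'rV[R]_n) : dot (- q) y = - dot q y.
Proof. by rewrite /dot -sumrN; apply: eq_bigr => i _; rewrite !mxE mulNr. Qed.

Lemma dotZr (q y : 'rV[R]_n) (c : R) : dot q (c *: y) = c * dot q y.
Proof. by rewrite /dot mulr_sumr; apply: eq_bigr => i _; rewrite !mxE mulrCA. Qed.

Lemma dot_norm_le (q y : 'rV[R]_n) : `|dot q y| <= (\sum_i `|q 0 i|) * `|y|.
Proof.
apply: (le_trans (ler_norm_sum _ _ _)); rewrite mulr_suml; apply: ler_sum => i _.
by rewrite normrM ler_wpM2l // ler_coord_norm.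
Qed.

Lemma dotDl (q q' y : 'rV[R]_n) : dot (q + q') y = dot q y + dot q' y.
Proof. by rewrite /dot -big_split /=; apply: eq_bigr => i _; rewrite mxE mulrDl. Qed.

End dot.

Section hamiltonian.
Context {R : realType} {n m p : nat}.
Variables (U : set 'rV[R]_m) (V : set 'rV[R]_p).
Variable f : 'rV[R]_n -> 'rV[R]_m -> 'rV[R]_p -> 'rV[R]_n.
Variable C : R.
Hypotheses (U_neq0 : U !=set0) (V_neq0 : V !=set0).
Hypothesis f_bounded : forall x u v, U u -> V v -> `|f x u v| <= C.

Local Notation H := (hamiltonian U V f).

Let inner_has_inf x q v : V v -> has_inf [set dot q (f x u v) | u in U].
Proof.
move=> Vv; split; first by have [u Uu] := U_neq0; exists (dot q (f x u v)), u.
exists (- ((\sum_i `|q 0 i|) * C)) => _ [u Uu <-].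
have := dot_norm_le q (f x u v); rewrite ler_norml => /andP[+ _]; apply: le_trans.
by rewrite lerN2 ler_wpM2l ?sumr_ge0 // f_bounded.
Qed.

Let outer_has_sup x q : has_sup [set inf [set dot q (f x u v) | u in U] | v in V].
Proof.
have [v Vv] := V_neq0; split; first by exists (inf [set dot q (f x u v) | u in U]), v.
exists ((\sum_i `|q 0 i|) * C) => _ [w Vw <-]; have [u Uu] := U_neq0.
apply: (@le_trans _ _ (dot q (f x u w))).
  by apply: ge_inf (inner_has_inf x q Vw).2 _ _; exists u.
apply: (le_trans (ler_norm _)); apply: (le_trans (dot_norm_le _ _)).
by rewrite ler_wpM2l ?sumr_ge0 // f_bounded.
Qed.

Lemma hamiltonian_lt x q a v : H x q < a -> V v -> exists2 u, U u & dot q (f x u v) < a.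
Proof.
move=> Ha Vv; have : inf [set dot q (f x u v) | u in U] < a.
  by apply: le_lt_trans Ha; apply: ub_le_sup (outer_has_sup x q).2 _ _; exists v.
rewrite -subr_gt0 => e0; have [_ [u Uu <-]] := inf_adherent e0 (inner_has_inf x q Vv).
by rewrite addrC subrK => lt; exists u.
Qed.

Lemma hamiltonian_gt x q a : a < H x q -> exists2 v, V v & forall u, U u -> a < dot q (f x u v).
Proof.
rewrite -subr_gt0 => e0; have [_ [v Vv <-]] := sup_adherent e0 (outer_has_sup x q).
rewrite subKr => lt; exists v => // u Uu; apply: lt_le_trans lt _.
by apply: ge_inf (inner_has_inf x q Vv).2 _ _; exists u.
Qed.

(** A [v] nearly optimal for [q] at [x] is answered by a [u] nearly optimal against it for [q'] at
    [y]; the hypothesis compares the two sides at this single pair. *)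
Lemma hamiltonian_le x y q q' c :
  (forall u v, U u -> V v -> dot q (f x u v) <= dot q' (f y u v) + c) -> H x q <= H y q' + c.
Proof.
move=> le; apply/ler_addgt0Pr => e e0; rewrite leNgt; apply/negP => /hamiltonian_gt [v Vv gt].
have lt : H y q' < H y q' + e by lra.
have [u Uu] := hamiltonian_lt lt Vv.
by have := gt u Uu; have := le u v Uu Vv; lra.
Qed.

End hamiltonian.

(** * Compact cylinders and the doubling penalty *)

Section cylinder.
Context {R : realType} {n : nat}.
Local Notation E := ('rV[R]_n * R)%type.

Definition cylinder (c : 'rV[R]_n) (r a b : R) : set E := closed_ball c r `*` [set` `[a, b]].

Lemma sqdistC (z w : E) : sqdist z w = sqdist w z.
Proof.
rewrite /sqdist -(sqrrN (w.2 - z.2)) opprB; congr (_ + _); apply: eq_bigr => i _.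
by rewrite -sqrrN opprB.
Qed.

Lemma sqdist_ge0 (z w : E) : 0 <= sqdist z w.
Proof. by rewrite addr_ge0 ?sqr_ge0 // sumr_ge0 // => i _; rewrite sqr_ge0. Qed.

Lemma sqdistxx (z : E) : sqdist z z = 0.
Proof. by rewrite /sqdist subrr expr0n addr0 big1 // => i _; rewrite subrr expr0n. Qed.

Lemma sqdist_coord (z w : E) i : (z.1 0 i - w.1 0 i) ^+ 2 <= sqdist w z.
Proof.
rewrite /sqdist (bigD1 i) //= -addrA lerDl addr_ge0 ?sqr_ge0 // sumr_ge0 // => j _.
exact: sqr_ge0.
Qed.

Lemma sqdist_time (z w : E) : (z.2 - w.2) ^+ 2 <= sqdist w z.
Proof. by rewrite /sqdist lerDr sumr_ge0 // => i _; exact: sqr_ge0. Qed.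

Lemma sqdist_lt_ball (z w : E) (e : R) : 0 < e -> sqdist w z < e ^+ 2 -> ball z e w.
Proof.
move=> e0 lt.
have sq (a : R) : a ^+ 2 <= sqdist w z -> `|a| < e.
  move=> le; rewrite -(ltr_pXn2r (n := 2)) ?nnegrE ?(ltW e0) //.
  by rewrite real_normK ?num_real // (le_lt_trans le).
split; last exact: sq (sqdist_time z w).
by split => // i j; rewrite ord1; exact: sq (sqdist_coord z w j).
Qed.

Lemma sqdist_continuous : continuous (fun zw : E * E => sqdist zw.2 zw.1).
Proof.
have cB (g g' : E * E -> R) x : g y @[y --> x] --> g x -> g' y @[y --> x] --> g' x ->
    (g y - g' y) ^+ 2 @[y --> x] --> (g x - g' x) ^+ 2.
  by move=> cg cg'; rewrite expr2; under eq_fun do rewrite expr2; apply: cvgM; exact: cvgB.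
have c1 i : continuous (fun zw : E * E => zw.1.1 0 i : R).
  move=> x; apply: (@continuous_comp _ _ _ (fun zw : E * E => zw.1.1) (fun y : 'rV[R]_n =>
    y 0 i)).
    by apply: (@continuous_comp _ _ _ fst fst); exact: cvg_fst.
  exact: coord_continuous.
have c2 i : continuous (fun zw : E * E => zw.2.1 0 i : R).
  move=> x; apply: (@continuous_comp _ _ _ (fun zw : E * E => zw.2.1) (fun y : 'rV[R]_n =>
    y 0 i)).
    by apply: (@continuous_comp _ _ _ snd fst); [exact: cvg_snd|exact: cvg_fst].
  exact: coord_continuous.
move=> x; apply: cvgD.
  apply: cvg_big => [|i _]; [exact: add_continuous|by apply: cB; [exact: c1|exact: c2]].
apply: cB.
  by apply: (@continuous_comp _ _ _ fst snd); [exact: cvg_fst|exact: cvg_snd].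
by apply: (@continuous_comp _ _ _ snd snd); exact: cvg_snd.
Qed.

Lemma cylinder_compact c r a b : 0 < r -> compact (cylinder c r a b).
Proof.
move=> r0; apply: compact_setX; last exact: segment_compact.
apply: bounded_closed_compact; last exact: closed_ball_closed.
exists (`|c| + r); split; first exact: num_real.
move=> M Mr y; rewrite closed_ballE //= => yr.
apply: le_trans (ltW Mr); rewrite -lerBlDl; apply: le_trans yr.
by rewrite distrC; exact: lerB_dist.
Qed.

Lemma cylinderP c r a b z : 0 < r ->
  cylinder c r a b z <-> `|c - z.1| <= r /\ a <= z.2 <= b.
Proof. by move=> r0; rewrite /cylinder closed_ballE //= in_itv. Qed.

(** Both test functions of the doubling argument have this form: coefficients [N] and 1 for the
    subsolution, [- N] and 0 for the supersolution. *)
Lemma test_function_partials (N s : R) (c z : E) (psi : E -> R) : rational_fun psi -> 0 < z.2 ->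
  let g := fun z => N * sqdist c z + s * psi z in
  partial_t g z = 2 * N * (z.2 - c.2) + s * partial_t psi z /\
  forall i, partial_x g z 0 i = 2 * N * (z.1 0 i - c.1 0 i) + s * partial_x psi z 0 i.
Proof.
move=> rpsi z0 g.
have D d : 'D_d g z = N * (2 * (\sum_i (z.1 0 i - c.1 0 i) * d.1 0 i + (z.2 - c.2) * d.2)) +
    s * 'D_d psi z.
  have [psi' _ Dpsi] := rational_fun_derive rpsi d.
  have := is_deriveD (@is_deriveZ R E R (sqdist c) N z d _ (is_derive_sqdist c z d))
    (@is_deriveZ R E R psi s z d _ (Dpsi z z0)).
  by case=> _ ->; case: (Dpsi z z0) => _ ->.
split=> [|i].
  rewrite /partial_t D /= big1 => [|i _]; last by rewrite mxE mulr0.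
  by ring.
rewrite !mxE D /= mulr0 addr0 (bigD1 i) //= big1 => [|j ji].
  by rewrite mxE !eqxx /= mulr1; ring.
by rewrite mxE (negbTE ji) andbF mulr0.
Qed.

Lemma sqdist_norm (z w : E) : `|z.1 - w.1| ^+ 2 <= sqdist w z.
Proof.
rewrite -[leRHS]sqr_sqrtr ?sqdist_ge0 // ler_pXn2r ?nnegrE ?sqrtr_ge0 //.
apply: rV_norm_le => [|i]; first exact: sqrtr_ge0.
by rewrite -sqrtr_sqr ler_wsqrtr // !mxE sqdist_coord.
Qed.

Lemma near_cylinder (x0 : 'rV[R]_n) r (c : E) a b : a < c.2 < b -> `|x0 - c.1| < r ->
  \forall z \near c, cylinder x0 r a b z.
Proof.
move=> /andP[ac cb] cr; have r0 : 0 < r by apply: le_lt_trans cr.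
apply/nbhs_ballP; exists (Num.min (r - `|x0 - c.1|) (Num.min (c.2 - a) (b - c.2))).
  by rewrite /= !lt_min !subr_gt0 cr ac.
move=> z [zx]; rewrite /ball /= !lt_min => /and3P[_ za zb].
apply/cylinderP => //; split.
  have {}zx : `|c.1 - z.1| < r - `|x0 - c.1|.
    have := le_ball (_ : _ <= r - `|x0 - c.1|) zx; rewrite -ball_normE /=; apply.
    by rewrite ge_min lexx.
  by have := ler_distD c.1 x0 z.1; lra.
by move: za zb; rewrite !ltr_norml; lra.
Qed.

End cylinder.

Section comparison.
Context {R : realType} {n m p : nat}.
Variables (U : set 'rV[R]_m) (V : set 'rV[R]_p).
Variable f : 'rV[R]_n -> 'rV[R]_m -> 'rV[R]_p -> 'rV[R]_n.
Variable h : 'rV[R]_n -> R.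
Variables T C L K : R.
Hypotheses (U_neq0 : U !=set0) (V_neq0 : V !=set0).
Hypotheses (C0 : 0 <= C) (L0 : 0 < L) (K0 : 0 <= K).
Hypothesis f_bounded : forall x u v, U u -> V v -> `|f x u v| <= C.
Hypothesis f_lipschitz : forall x y u v, U u -> V v -> `|f x u v - f y u v| <= L * `|x - y|.
Hypothesis h_lipschitz : forall x y, `|h x - h y| <= K * `|x - y|.

Local Notation H := (hamiltonian U V f).
Local Notation E := ('rV[R]_n * R)%type.
Local Notation strip := [set z : E | 0 <= z.2 <= T].
Local Notation interior_strip := [set z : E | 0 < z.2 < T].

Definition viscosity_sub (F : E -> R) := forall z W', 0 < z.2 < T ->
  smooth_on interior_strip W' ->
  local_max (F \- W') z -> 0 <= vi_expr U V f h F W' z.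

Definition viscosity_super (F : E -> R) := forall z W', 0 < z.2 < T ->
  smooth_on interior_strip W' ->
  local_min (F \- W') z -> vi_expr U V f h F W' z <= 0.

(** It carries an estimate between Hamiltonians over to the truncated ones of the equation. *)
Lemma min0_leD (a b c : R) : 0 <= c -> a <= b + c -> Num.min 0 a <= Num.min 0 b + c.
Proof.
move=> c0 abc; have [b0|b0] := leP 0 b; first by rewrite ge_min; apply/orP; left; lra.
by rewrite ge_min abc orbT.
Qed.

(** Doubling of variables for an abstract penalty [psi]: above [M] on the bottom and the lateral
    boundary, and strictly decreasing along the worst motion of speed [C]. Only [z] is penalized and
    confined to the small cylinder; [w] ranges over a larger one, so closeness to [z] is enough to
    make it interior. *)
Lemma doubling_contradiction (F1 F2 : E -> R) (psi : E ->
  R) (x0 : 'rV[R]_n) (t0 rho tau M Delta th : R) :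
  {within strip, continuous F1} -> {within strip, continuous F2} ->
  viscosity_sub F1 -> viscosity_super F2 ->
  (forall x, F1 (x, T) <= F2 (x, T)) ->
  0 < tau -> tau < t0 -> t0 < T -> 0 < rho -> 0 < Delta -> 0 < th ->
  (forall z w, cylinder x0 (rho + 1) 0 T z -> cylinder x0 (rho + 1) 0 T w ->
    F1 z - F2 w <= M) ->
  rational_fun psi ->
  (forall z, cylinder x0 rho tau T z -> 0 <= psi z) ->
  (forall z, cylinder x0 rho tau T z -> z.2 = tau \/ `|x0 - z.1| = rho -> M < psi z) ->
  (forall z, cylinder x0 rho tau T z ->
    partial_t psi z + C * (\sum_i `|partial_x psi z 0 i|) <= - th) ->
  Delta + psi (x0, t0) <= F1 (x0, t0) - F2 (x0, t0) -> False.
Proof.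
(* The final contradiction: on subtracting the two viscosity inequalities the time derivatives of
   the quadratic penalty cancel. *)
have arith (N a b m1 m2 c1 c2 pt pt' : R) : 0 <= 2 * N * (a - b) + 1 * pt + m1 ->
    2 * - N * (b - a) + 0 * pt' + m2 <= 0 -> pt + c1 + c2 < 0 -> m1 <= m2 + (c1 + c2) -> False.
  by lra.
move=> c1 c2 sub super term tau0 taut0 t0T rho0 De0 th0 FM rpsi psi0 psiM psith center.
have rho10 : 0 < rho + 1 by lra.
have T0 : 0 < T by lra.
set Q := cylinder x0 (rho + 1) 0 T; set Q1 := cylinder x0 rho tau T.
have Q1P z := cylinderP x0 tau T z rho0; have QP z := cylinderP x0 0 T z rho10.
have Q1Q : Q1 `<=` Q by move=> z /Q1P [? ?]; apply/QP; lra.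
have Qstrip : Q `<=` strip by move=> z /QP [].
have Qz0 : Q1 (x0, t0) by apply/Q1P; rewrite /= subrr normr0; lra.
have M0 : 0 < M.
  have := FM _ _ (Q1Q _ Qz0) (Q1Q _ Qz0); have := psi0 _ Qz0; lra.
have nL0 : 0 < 2 * n%:R * L + 1 by rewrite ltr_wpDl // !mulr_ge0 // ltW.
(* The first bound excludes time [T]; the second keeps the Hamiltonian error [2 * n * L * e] below
   the margin [th]. *)
pose e := Num.min (Delta / 4) (th / (2 * n%:R * L + 1)).
have e0 : 0 < e by rewrite lt_min !divr_gt0.
have cptQ : compact Q by exact: cylinder_compact.
have [d1 d10 u1] := compact_uniformly_continuous cptQ Qstrip c1 e0.
have [d2 d20 u2] := compact_uniformly_continuous cptQ Qstrip c2 e0.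
have K10 : 0 < K + 1 by rewrite ltr_wpDl.
(* In order: the moduli of continuity of [F1] and [F2] for [e], then what keeps [w] within radius
   [rho + 1], at a positive time, and the obstacle error [K * eta] below [Delta / 4]. *)
pose eta := Num.min (Num.min d1 d2) (Num.min 1 (Num.min (tau / 2) (Delta / 4 / (K + 1)))).
have eta0 : 0 < eta by rewrite !lt_min d10 d20 ltr01 !divr_gt0.
have [etad1 etad2] : eta <= d1 /\ eta <= d2 by rewrite !ge_min !lexx ?orbT.
have [eta1 [etatau etaK]] : eta <= 1 /\ eta <= tau / 2 /\ eta <= Delta / 4 / (K + 1).
  by rewrite !ge_min !lexx ?orbT.
(* At the maximum the quadratic penalty is at most [M - Delta], so this [N] forces the two points
   within [eta]. *)
pose N := M / eta ^+ 2.
have N0 : 0 < N by rewrite divr_gt0 // exprn_gt0.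
pose Phi (zw : E * E) := F1 zw.1 - F2 zw.2 - N * sqdist zw.2 zw.1 - psi zw.1.
have [[z w] + Phimax] : exists2 c, c \in Q1 `*` Q & forall c', c' \in Q1 `*` Q ->
  Phi c' <= Phi c.
  apply: compact_EVT_max.
  - by exists ((x0, t0), (x0, t0)); split => //; exact: Q1Q.
  - by apply: compact_setX; exact: cylinder_compact.
  - apply/subspace_continuousP => -[z w] [/= Qz Qw].
    have cw (F : E -> R) (pr : E * E -> E) (zw : E * E) : {within strip, continuous F} ->
      strip (pr zw) ->
        pr @ zw --> pr zw ->
        (forall zw', (Q1 `*` Q) zw' -> strip (pr zw')) ->
        F (pr zw') @[zw' --> within (Q1 `*` Q) (nbhs zw)] --> F (pr zw).
      move=> cF sz cpr sQ; apply/cvgrPdist_lt => e' e'0; rewrite near_withinE.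
      have near_pr : \forall zw' \near zw, strip (pr zw') -> `|F (pr zw) - F (pr zw')| < e'.
        exact: cpr _ (within_continuous_near cF sz e'0).
      by apply: filterS near_pr => zw' near_zw' Qzw'; apply: near_zw'; exact: sQ.
    have z0 : 0 < z.2 by have [_] := (Q1P z).1 Qz; lra.
    apply: cvgB; [apply: cvgB; [apply: cvgB|]|].
    + apply: (cw F1 fst (z, w)) => //; [exact/Qstrip/Q1Q|exact: cvg_fst|].
      by move=> zw' [Qz' _]; exact/Qstrip/Q1Q.
    + apply: (cw F2 snd (z, w)) => //; [exact/Qstrip|exact: cvg_snd|].
      by move=> zw' [_ Qw']; exact/Qstrip.
    + apply: cvgM; first exact: cvg_cst.
      by apply: cvg_within_filter; exact: (@sqdist_continuous R n (z, w)).
    + apply: cvg_within_filter.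
      apply: (@cvg_comp _ _ _ fst psi _ (nbhs z)); first exact: cvg_fst.
      exact: rational_fun_continuous rpsi z z0.
rewrite inE => -[/= Qz Qw].
have max z' w' : Q1 z' -> Q w' -> Phi (z', w') <= Phi (z, w).
  by move=> Qz' Qw'; apply: Phimax; rewrite inE.
have PhiD : Delta <= Phi (z, w).
  by apply: le_trans (max _ _ Qz0 (Q1Q _ Qz0)); rewrite /Phi /= sqdistxx; lra.
rewrite /Phi /= in PhiD.
have psiz := psi0 z Qz; have FMzw := FM z w (Q1Q _ Qz) Qw.
have sq0 : 0 <= N * sqdist w z by rewrite mulr_ge0 ?sqdist_ge0 // ltW.
have zw_eta : ball z eta w.
  apply: sqdist_lt_ball => //; rewrite -(ltr_pM2l N0) {2}/N divfK ?gt_eqF ?exprn_gt0 //; lra.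
have [zx zt] := (Q1P z).1 Qz; have [wx wt] := (QP w).1 Qw.
have [zwx zwt] := zw_eta.
have zwx' : `|z.1 - w.1| < eta by move: zwx; rewrite -ball_normE.
have zwt' : `|z.2 - w.2| < eta by [].
have F2e : `|F2 z - F2 w| < e by apply: u2 => //; [exact: Q1Q|exact: le_ball zw_eta].
have F1e : `|F1 z - F1 w| < e by apply: u1 => //; [exact: Q1Q|exact: le_ball zw_eta].
have eD : e <= Delta / 4 by rewrite ge_min lexx.
(* Comparing the maximum with the diagonal pair [(z, z)] improves the bound on the penalty from [M]
   to the oscillation of [F2]. *)
have NF2 : N * sqdist w z <= e.
  have := max z z Qz (Q1Q _ Qz); rewrite /Phi /= sqdistxx.
  by move: F2e; rewrite ltr_norml; lra.
have ztT : z.2 < T.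
  have /andP[_] := zt; rewrite le_eqVlt => /orP[/eqP zT|//].
  have := term z.1; rewrite -zT -surjective_pairing; move: F2e; rewrite ltr_norml; lra.
have wtT : w.2 < T.
  have /andP[_] := wt; rewrite le_eqVlt => /orP[/eqP wT|//].
  have := term w.1; rewrite -wT -surjective_pairing; move: F1e; rewrite ltr_norml; lra.
have zxr : `|x0 - z.1| < rho.
  rewrite lt_neqAle zx andbT; apply/eqP => H; have := psiM z Qz (or_intror H); lra.
have ztau : tau < z.2.
  have /andP[+ _] := zt; rewrite le_eqVlt => /orP[/eqP H|//].
  have := psiM z Qz (or_introl (esym H)); lra.
have wt0 : 0 < w.2 by move: zwt'; rewrite ltr_norml; lra.
have wxr : `|x0 - w.1| < rho + 1.
  have := ler_distD z.1 x0 w.1; lra.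
pose W1 := fun z' => N * sqdist w z' + 1 * psi z'.
pose W2 := fun w' => - N * sqdist z w' + 0 * psi w'.
have rW c k s : rational_fun (fun z' : E => k * sqdist c z' + s * psi z').
  apply: rational_add; apply: rational_mul => //; try exact: rational_cst.
  exact: rational_sqdist.
have z20 : 0 < z.2 by lra.
have lmax : local_max (F1 \- W1) z.
  apply: filterS (near_cylinder (_ : tau < z.2 < T) zxr); last by rewrite ztau.
  move=> z' Qz'; have := max z' w Qz' Qw; rewrite /Phi /W1 /=; lra.
have lmin : local_min (F2 \- W2) w.
  apply: filterS (near_cylinder (_ : 0 < w.2 < T) wxr); last by rewrite wt0.
  move=> w' Qw'; have := max z w' Qz Qw'; rewrite /Phi /W2 /= (sqdistC w') (sqdistC w); lra.
have zT : 0 < z.2 < T by rewrite z20.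
have wT : 0 < w.2 < T by rewrite wt0.
have h1 := sub z W1 zT (rational_fun_smooth (rW w N 1)) lmax.
have h2 := super w W2 wT (rational_fun_smooth (rW z (- N) 0)) lmin.
have [W1t W1x] : partial_t W1 z = _ /\ (forall i,
  partial_x W1 z 0 i = _) := test_function_partials N 1 w rpsi z20.
have [W2t W2x] : partial_t W2 w = _ /\ (forall i,
  partial_x W2 w 0 i = _) := test_function_partials (- N) 0 z rpsi wt0.
clearbody W1 W2; clear lmax lmin max Phimax.
move: h2; rewrite /vi_expr ge_max subr_le0 => /andP[hw H2].
(* In the obstacle case [F1 z <= h z.1] and [h w.1 <= F2 w], so the gap [Delta] is at most
   [K * eta]. *)
move: h1; rewrite /vi_expr le_max => /orP[hz|H1].
  have hzw := h_lipschitz z.1 w.1.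
  have : K * `|z.1 - w.1| <= Delta / 4.
    have : (K + 1) * eta <= Delta / 4 by rewrite mulrC -ler_pdivlMr.
    have : K * `|z.1 - w.1| <= K * eta by rewrite ler_wpM2l // ltW.
    lra.
  by move: hzw; rewrite ler_norml; lra.
(* The two momenta differ by the gradient of [psi], which costs at most [C] times its l1-norm.
   Moving the state from [z.1] to [w.1] costs [L * |z.1 - w.1|] times the l1-norm of a momentum
   whose [n] entries are at most [2 * N * |z.1 - w.1|]. *)
have Hle : H z.1 (partial_x W1 z) <= H w.1 (partial_x W2 w) +
    (C * (\sum_i `|partial_x psi z 0 i|) + 2 * n%:R * L * (N * sqdist w z)).
  apply: (hamiltonian_le U_neq0 V_neq0 f_bounded) => u v Uu Vv.
  have qE : partial_x W1 z = partial_x W2 w + partial_x psi z.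
    by apply/rowP => i; rewrite W1x [RHS]mxE W2x; ring.
  have -> : dot (partial_x W1 z) (f z.1 u v) = dot (partial_x W2 w) (f w.1 u v) +
      (dot (partial_x psi z) (f z.1 u v) + dot (partial_x W2 w) (f z.1 u v - f w.1 u v)).
    by rewrite dotBr qE dotDl; ring.
  rewrite lerD2l; apply: lerD.
    apply: (le_trans (ler_norm _)); apply: (le_trans (dot_norm_le _ _)).
    by rewrite mulrC ler_wpM2r ?sumr_ge0 // f_bounded.
  apply: (le_trans (ler_norm _)); apply: (le_trans (dot_norm_le _ _)).
  apply: (@le_trans _ _ ((n%:R * (2 * N * `|z.1 - w.1|)) * (L * `|z.1 - w.1|))).
    apply: ler_pM; rewrite ?sumr_ge0 ?f_lipschitz // mulr_natl.
    have -> : (2 * N * `|z.1 - w.1|) *+ n = \sum_(i < n) 2 * N * `|z.1 - w.1|.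
      by rewrite sumr_const card_ord.
    apply: ler_sum => i _; rewrite W2x mul0r addr0 (_ : _ * _ = 2 * N * (z.1 0 i - w.1 0 i));
      last by ring.
    have N20 : 0 < 2 * N by rewrite mulr_gt0.
    rewrite normrM (gtr0_norm N20) ler_pM2l //.
    by have := ler_coord_norm (z.1 - w.1) i; rewrite !mxE.
  have := sqdist_norm z w; set a := `|_|; set sq := sqdist _ _ => asq.
  rewrite (_ : _ * _ = 2 * n%:R * L * (N * a ^+ 2)); last by ring.
  by rewrite ler_wpM2l ?ler_pM2l // !mulr_ge0 // ltW.
have neg : partial_t psi z + C * (\sum_i `|partial_x psi z 0 i|) + 2 * n%:R * L * (N * sqdist
  w z) < 0.
  have := psith z Qz; have : (2 * n%:R * L + 1) * e <= th by rewrite mulrC -ler_pdivlMr //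
    ge_min lexx orbT.
  have : 2 * n%:R * L * (N * sqdist w z) <= 2 * n%:R * L * e.
    by apply: ler_wpM2l => //; rewrite !mulr_ge0 // ltW.
  lra.
have cc0 : 0 <= C * (\sum_i `|partial_x psi z 0 i|) + 2 * n%:R * L * (N * sqdist w z).
  apply: addr_ge0; first by rewrite mulr_ge0 // sumr_ge0.
  by apply: mulr_ge0 sq0; rewrite !mulr_ge0 // ltW.
move: H1 H2; rewrite W1t W2t => H1 H2.
exact: (arith _ _ _ _ _ _ _ _ _ H1 H2 neg (min0_leD cc0 Hle)).
Qed.

(** * The barrier and its strict decrease *)

Section barrier.
Variables (x0 : 'rV[R]_n) (A D kap lam : R) (k : nat).
Hypotheses (A0 : 0 <= A) (D0 : 0 < D) (kap0 : 0 <= kap) (lam0 : 0 < lam).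

Definition paraboloid (z : E) : R := (\sum_i (z.1 0 i - x0 0 i) ^+ 2 + A * (T - z.2) + 1) / D.

Definition barrier (z : E) : R := kap * paraboloid z ^+ k + lam * z.2^-1.

Lemma barrier_rational : rational_fun barrier.
Proof.
have rB (g : E -> R) (a : R) : rational_fun g -> rational_fun (fun z => g z + a).
  by move=> rg; apply: rational_add => //; exact: rational_cst.
have rS (g : E -> R) (a : R) : rational_fun g -> rational_fun (fun z => a * g z).
  by move=> rg; apply: rational_mul => //; exact: rational_cst.
apply: rational_add; last exact: rS rational_inv_time.
apply: (rS); apply: rational_exp; apply: rational_mul; last exact: rational_cst.
apply: (rB); apply: rational_add.
  by apply: rational_sum => i; apply: rational_exp; apply: (rB); exact: rational_coord.
apply: (rS); rewrite (_ : (fun _ => _) = fun z : E => -1 * z.2 + T);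
  first exact/rB/rS/rational_time.
by apply/funext => z; ring.
Qed.

Lemma paraboloid_ge0 z : z.2 <= T -> 0 <= paraboloid z.
Proof.
move=> zT; rewrite divr_ge0 ?(ltW D0) // !addr_ge0 ?mulr_ge0 ?subr_ge0 //.
by rewrite sumr_ge0 // => i _; exact: sqr_ge0.
Qed.

Lemma barrier_derive z d : 0 < z.2 -> 'D_d barrier z =
  kap * (k%:R * paraboloid z ^+ k.-1) / D * (2 * (\sum_i (z.1 0 i - x0 0 i) * d.1 0 i) - A *
    d.2)
  - lam * z.2 ^- 2 * d.2.
Proof.
move=> z0; have z0' := lt0r_neq0 z0.
have D1 : is_derive z d paraboloid (D^-1 * (2 * (\sum_i (z.1 0 i - x0 0 i) * d.1 0 i) - A *
  d.2)).
  have d1 := is_derive_sum_sq x0 z d.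
  have d2 := @is_deriveZ R E R _ (- A) z d _ (is_derive_time z d).
  have d3 := is_deriveD (is_deriveD d1 d2) (is_derive_cst (A * T + 1) z d).
  have := @is_deriveZ R E R _ D^-1 z d _ d3; rewrite addr0; congr (is_derive _ _ _ _);
    last first.
    by congr (_ * (_ + _)); exact: mulNr.
  apply/funext => w; rewrite /paraboloid [RHS]mulrC; congr (_ * _).
  suff -> : \sum_i (w.1 0 i - x0 0 i) ^+ 2 + A * (T - w.2) + 1 =
    \sum_i (w.1 0 i - x0 0 i) ^+ 2 + - A * w.2 + (A * T + 1) by [].
  ring.
have D2 := @is_deriveZ R E R _ kap z d _ (is_deriveX k D1).
have D3 := @is_deriveZ R E R _ lam z d _ (is_derive_inv_time d z0').
have := is_deriveD D2 D3; rewrite exprfctE => D4.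
have [_ ->] : is_derive z d barrier _ := D4.
by rewrite /GRing.scale /=; ring.
Qed.

(** With [P] the factor from the chain rule, the paraboloid contributes [- P * A] in time and at
    most [C * n * P * 2 * rho = P * A] through the gradient, for any exponent [k]. These cancel, and
    the inverse time term leaves the margin. *)
Lemma barrier_decreasing (rho : R) z : A = 2 * C * n%:R * rho -> `|x0 - z.1| <= rho ->
  0 < z.2 <= T ->
  partial_t barrier z + C * (\sum_i `|partial_x barrier z 0 i|) <= - (lam / T ^+ 2).
Proof.
move=> AE zr /andP[z0 zT].
set P := kap * (k%:R * paraboloid z ^+ k.-1) / D.
have P0 : 0 <= P.
  by rewrite /P !mulr_ge0 // ?invr_ge0 ?(ltW D0) // exprn_ge0 // paraboloid_ge0.
have -> : partial_t barrier z = - P * A - lam * z.2 ^- 2.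
  rewrite /partial_t barrier_derive //= big1 => [|i _]; last by rewrite mxE mulr0.
  rewrite -/P; ring.
have px i : `|partial_x barrier z 0 i| <= P * (2 * rho).
  rewrite mxE barrier_derive //= (bigD1 i) //= big1 => [|j ji]; last first.
    by rewrite mxE (negbTE ji) andbF mulr0.
  rewrite mxE !eqxx /= -/P mulr1 addr0 !mulr0 !subr0 normrM (ger0_norm P0) ler_wpM2l //.
  rewrite normrM ger0_norm // ler_wpM2l //; apply: le_trans zr.
  by have := ler_coord_norm (x0 - z.1) i; rewrite !mxE distrC.
have s1 : C * (\sum_i `|partial_x barrier z 0 i|) <= P * A.
  rewrite AE (_ : P * _ = C * (n%:R * (P * (2 * rho)))); last by ring.
  apply: ler_wpM2l => //; rewrite mulr_natl.
  have -> : P * (2 * rho) *+ n = \sum_(i < n) P * (2 * rho) by rewrite sumr_const card_ord.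
  by apply: ler_sum => i _.
have s2 : lam / T ^+ 2 <= lam * z.2 ^- 2.
  apply: ler_wpM2l; first exact: ltW.
  have T0 : 0 < T by apply: lt_le_trans zT.
  by rewrite lef_pV2 ?posrE ?exprn_gt0 // ler_pXn2r ?nnegrE ?(ltW T0) ?(ltW z0).
lra.
Qed.

End barrier.

Lemma comparison_interior (F1 F2 : E -> R) (x0 : 'rV[R]_n) (t0 : R) :
  {within strip, continuous F1} -> {within strip, continuous F2} ->
  viscosity_sub F1 -> viscosity_super F2 ->
  (forall x, F1 (x, T) <= F2 (x, T)) ->
  0 < t0 < T -> F1 (x0, t0) <= F2 (x0, t0).
Proof.
move=> c1 c2 sub super term /andP[t00 t0T].
rewrite -subr_le0 leNgt; apply/negP; set Delta := F1 _ - _ => De0.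
have T0 : 0 < T by lra.
(* These constants give b <= 1 at the centre, b >= 2 where |x - x0| = rho, and
   A = 2 C n rho, the bound of C times the l1-norm of the gradient of
   |x - x0|^2 on the cylinder. *)
pose rho := 4 * C * n%:R * T + 1; pose A := 2 * C * n%:R * rho; pose D := A * T + 1.
have rho1 : 1 <= rho by rewrite /rho lerDr !mulr_ge0 // ltW.
have rho0 : 0 < rho by lra.
have rho10 : 0 < rho + 1 by lra.
have A0 : 0 <= A by rewrite !mulr_ge0 // ltW.
have D0 : 0 < D by rewrite ltr_wpDl // mulr_ge0 // ltW.
pose Q := cylinder x0 (rho + 1) 0 T.
have cptQ : compact Q by exact: cylinder_compact.
have Qstrip : Q `<=` strip by move=> z /(cylinderP _ _ _ _ rho10) [].
have Q0 : Q !=set0.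
  by exists (x0, t0); apply/(cylinderP _ _ _ _ rho10); rewrite /= subrr normr0; split; lra.
have [z1 _ max1] := compact_EVT_max Q0 cptQ (continuous_subspaceW Qstrip c1).
have [z2 _ min2] := compact_EVT_min Q0 cptQ (continuous_subspaceW Qstrip c2).
pose M := F1 z1 - F2 z2.
have FM z w : Q z -> Q w -> F1 z - F2 w <= M.
  by move=> Qz Qw; apply: lerB; [apply: max1|apply: min2]; rewrite inE.
have M1 : 0 < `|M| + 1 by rewrite ltr_wpDl.
have MM : M < `|M| + 1 by have := ler_norm M; lra.
(* [kap = Delta / 4] and [lam = Delta / 4 * t0] make the barrier at the centre at most [Delta / 2],
   so half of the gap survives. *)
have kap0 : 0 < Delta / 4 by rewrite divr_gt0.
have lam0 : 0 < Delta / 4 * t0 by rewrite mulr_gt0.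
have [k _ /(_ k (leqnn k)) /=] := near_infty_natSinv_expn_lt (PosNum (divr_gt0 kap0 M1)).
rewrite div1r ltr_pdivlMr // mulrC ltr_pdivrMr ?exprn_gt0 // => kM.
(* The second bound makes [lam / tau] exceed [M] on the bottom of the cylinder. *)
pose tau := Num.min (t0 / 2) (Delta / 4 * t0 / (`|M| + 1)).
have tau0 : 0 < tau by rewrite lt_min !divr_gt0.
have taut0 : tau < t0 by rewrite gt_min; apply/orP; left; lra.
have tauM : `|M| + 1 <= Delta / 4 * t0 / tau.
  by rewrite ler_pdivlMr // mulrC -ler_pdivlMr // ge_min lexx orbT.
have th0 : 0 < Delta / 4 * t0 / T ^+ 2 by rewrite divr_gt0 // exprn_gt0.
have De20 : 0 < Delta / 2 by rewrite divr_gt0.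
have Q1P z := cylinderP x0 tau T z rho0.
have b0 z : z.2 <= T -> 0 <= paraboloid x0 A D z by exact: paraboloid_ge0.
apply: (@doubling_contradiction F1 F2 (barrier x0 A D (Delta / 4) (Delta / 4 * t0) k)
  x0 t0 rho tau M (Delta / 2) (Delta / 4 * t0 / T ^+ 2)) => //.
- exact: barrier_rational.
- move=> z /Q1P [_ /andP[tz zT]];
  rewrite /barrier addr_ge0 // mulr_ge0 ?(ltW kap0) ?(ltW lam0) //.
    by rewrite exprn_ge0 // b0.
  by rewrite invr_ge0 (le_trans (ltW tau0) tz).
- move=> z /Q1P [zr /andP[tz zT]] H.
  have z0 : 0 < z.2 by apply: lt_le_trans tz.
  have p1 : 0 <= Delta / 4 * paraboloid x0 A D z ^+ k by rewrite mulr_ge0 ?(ltW kap0) //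
    exprn_ge0 // b0.
  have p2 : 0 <= Delta / 4 * t0 * z.2^-1 by rewrite mulr_ge0 ?(ltW lam0) // invr_ge0 ltW.
  case: H => [zt|zrho]; rewrite /barrier.
    by rewrite zt; lra.
  suff : 2 ^+ k <= paraboloid x0 A D z ^+ k.
    move=> le; have : Delta / 4 * 2 ^+ k <= Delta / 4 * paraboloid x0 A D z ^+ k by rewrite
      ler_pM2l.
    by lra.
  rewrite lerXn2r ?nnegrE ?b0 // /paraboloid ler_pdivlMr //.
  have := sqdist_norm (z.1, 0 : R) (x0, 0 : R);
    rewrite /sqdist /= subrr expr0n /= addr0 distrC zrho => S.
  have : 0 <= A * (T - z.2) by rewrite mulr_ge0 // subr_ge0.
  (* As [1 <= rho], this gives [rho ^+ 2 + 1 >= 2 * D], so the paraboloid is at least 2 on the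
     lateral boundary. *)
  have : rho ^+ 2 = 2 * (A * T) + rho by rewrite /A /rho; ring.
  rewrite /D; lra.
- move=> z /Q1P [zr /andP[tz zT]].
  apply: (@barrier_decreasing x0 A D _ _ k _ _ _ _ rho) => //; first exact: ltW.
  by rewrite zT andbT (lt_le_trans tau0).
- rewrite /barrier /= mulfK ?gt_eqF //.
  have : paraboloid x0 A D (x0, t0) ^+ k <= 1.
    apply: exprn_ile1; first by apply: b0; exact: ltW.
    rewrite /paraboloid ler_pdivrMr // big1 => [|i _]; last by rewrite subrr expr0n.
    by rewrite add0r mul1r /D lerD2r ler_wpM2l // gerBl ltW.
  move=> b1; have : Delta / 4 * paraboloid x0 A D (x0,
    t0) ^+ k <= Delta / 4 by rewrite ler_piMr // ltW.
  rewrite -/Delta; lra.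
Qed.

(** The equation is tested only at times strictly between 0 and [T], so the slice [t = 0] is reached
    by continuity; for [T = 0] the terminal condition is all there is. *)
Theorem comparison (F1 F2 : E -> R) :
  {within strip, continuous F1} -> {within strip, continuous F2} ->
  viscosity_sub F1 -> viscosity_super F2 ->
  (forall x, F1 (x, T) <= F2 (x, T)) ->
  forall x t, 0 <= t <= T -> F1 (x, t) <= F2 (x, t).
Proof.
move=> c1 c2 sub super term x t /andP[t0 tT].
have [->//|tneT] := eqVneq t T.
have tltT : t < T by rewrite lt_neqAle tneT.
have [tpos|tle0] := ltP 0 t; first by apply: comparison_interior => //; rewrite tpos.
have t00 : t = 0 by lra.
rewrite t00 in tltT *.
apply/ler_addgt0Pr => e e0.
have e20 : 0 < e / 2 by rewrite divr_gt0.
have S0 : strip (x, 0) by rewrite /= lexx ltW.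
have near0 : \forall z \near ((x, 0) : E), (strip z -> `|F1 (x, 0) - F1 z| < e / 2) /\
    (strip z -> `|F2 (x, 0) - F2 z| < e / 2).
  by apply: filterI; [exact: within_continuous_near c1 S0 e20|exact: within_continuous_near
    c2 S0 e20].
have /nbhs_ballP [r /= r0 rP] := near0.
pose s := Num.min (r / 2) (T / 2).
have s0 : 0 < s by rewrite lt_min !divr_gt0.
have sT : s <= T / 2 by rewrite ge_min lexx orbT.
have sr : s <= r / 2 by rewrite ge_min lexx.
have [|h1 h2] := rP (x, s).
  by split; [exact: ballxx|rewrite /ball /= sub0r normrN gtr0_norm //; lra].
have Ss : strip (x, s) by rewrite /=; lra.
have : F1 (x, s) <= F2 (x, s) by apply: comparison_interior => //; lra.
by have := h1 Ss; have := h2 Ss; rewrite !ltr_norml; lra.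
Qed.

End comparison.
(** * The value function *)

Section controls.
Context {R : realType}.

Lemma controlsW (X : normedModType R) (A : set X) (a b a' b' : R) c : a <= a' -> b' <= b ->
  controls A a b c -> controls A a' b' c.
Proof.
move=> aa bb [Ac mc]; split=> [s sab|]; first by apply: Ac; lra.
apply/lebesgue_measurable_funP => [|G oG]; first exact: lebesgue_set_itv.
rewrite (_ : _ `&` _ = [set` `[a', b']] `&` ([set` `[a, b]] `&` c @^-1` G)).
  apply: lebesgue_setI; first exact: lebesgue_set_itv.
  by move: G oG; apply/lebesgue_measurable_funP => //; exact: lebesgue_set_itv.
apply/seteqP; split => s /=; rewrite !in_itv /= => -[sab ]; last by case.
by move=> Gs; split => //; split => //; lra.
Qed.

Lemma controls_cst (X : normedModType R) (A : set X) a b x : A x -> controls A a b (fun=> x).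
Proof.
move=> Ax; split => //; apply/lebesgue_measurable_funP => [|G oG];
  first exact: lebesgue_set_itv.
have [Gx|nGx] := pselect (G x).
  by rewrite (_ : _ @^-1` _ = setT) ?setIT; [exact: lebesgue_set_itv|apply/seteqP; split].
rewrite (_ : _ @^-1` _ = set0) ?setI0; last by apply/seteqP; split.
by apply: lebesgue_set_borel; exact: measurable0.
Qed.

Definition concat (X : Type) (s : R) (c1 c2 : R ->
  X) (r : R) : X := if r < s then c1 r else c2 r.

Lemma controls_concat (X : normedModType R) (A : set X) a s b c1 c2 : a <= s -> s <= b ->
  controls A a s c1 -> controls A s b c2 -> controls A a b (concat s c1 c2).
Proof.
move=> as_ sb [A1 m1] [A2 m2]; split.
  by move=> r rab; rewrite /concat; case: ltP => rs; [apply: A1|apply: A2]; lra.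
have {}m1 := (lebesgue_measurable_funP c1 (lebesgue_set_itv `[a, s])).1 m1.
have {}m2 := (lebesgue_measurable_funP c2 (lebesgue_set_itv `[s, b])).1 m2.
apply/lebesgue_measurable_funP => [|G oG]; first exact: lebesgue_set_itv.
rewrite (_ : _ `&` _ = [set` `[a, s[] `&` ([set` `[a, s]] `&` c1 @^-1` G) `|`
    ([set` `[s, b]] `&` c2 @^-1` G)).
  apply: lebesgue_setU; last exact: m2.
  by apply: lebesgue_setI; [exact: lebesgue_set_itv|exact: m1].
apply/seteqP; split => r /=; rewrite !in_itv /= /concat.
  by case: ltP => rs [rab Gr]; [left|right]; split => //; try split => //; lra.
by case: ltP => rs [[? [? ?]]|[? ?]]; split => //; lra.
Qed.

Lemma ae_concat_left (X : Type) a s (c1 c2 : R -> X) :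
  {ae lebesgue_measure, forall r : R, a <= r <= s -> concat s c1 c2 r = c1 r}.
Proof.
apply: aeS (ae_neq s) => r rs /andP[_ r_s]; rewrite /concat lt_neqAle r_s andbT.
by case: eqP.
Qed.

Lemma concat_right (X : Type) s (c1 c2 : R -> X) r : s <= r -> concat s c1 c2 r = c2 r.
Proof. by rewrite /concat ltNge => ->. Qed.

End controls.

Section game.
Context {R : realType} {n m p : nat}.
Variables (U : set 'rV[R]_m) (V : set 'rV[R]_p).
Variable f : 'rV[R]_n -> 'rV[R]_m -> 'rV[R]_p -> 'rV[R]_n.
Variables l h : 'rV[R]_n -> R.
Variables T C L B K : R.
Hypotheses (U_neq0 : U !=set0) (V_neq0 : V !=set0).
Hypotheses (C0 : 0 <= C) (L0 : 0 < L) (K0 : 0 <= K).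
Hypothesis f_bounded : forall x u v, U u -> V v -> `|f x u v| <= C.
Hypothesis f_lipschitz : forall x y u v, U u -> V v -> `|f x u v - f y u v| <= L * `|x - y|.
Hypothesis f_continuous : forall x,
  {within U `*` V, continuous (fun w => f x w.1 w.2)}.
Hypothesis l_bounded : forall x, `|l x| <= B.
Hypothesis h_bounded : forall x, `|h x| <= B.
Hypothesis l_lipschitz : forall x y, `|l x - l y| <= K * `|x - y|.
Hypothesis h_lipschitz : forall x y, `|h x - h y| <= K * `|x - y|.

Local Notation W := (aug_inputs U).
Local Notation dyn := (aug_dyn f).
Local Notation flow := (aug_flow f T).

(** * The augmented dynamics and its trajectories *)

Lemma aug_dyn_bounded x w b : W w -> V b -> `|dyn x w b| <= C.
Proof.
case: w => u c [/= Uu]; rewrite in_itv /= => /andP[c0 c1] Vb.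
rewrite /aug_dyn normrZ (ger0_norm c0) /=.
by apply: le_trans (f_bounded x Uu Vb); rewrite ler_piMl.
Qed.

Lemma aug_dyn_lipschitz x y w b : W w -> V b -> `|dyn x w b - dyn y w b| <= L * `|x - y|.
Proof.
case: w => u c [/= Uu]; rewrite in_itv /= => /andP[c0 c1] Vb.
rewrite /aug_dyn -scalerBr normrZ (ger0_norm c0) /=.
by apply: le_trans (f_lipschitz x y Uu Vb); rewrite ler_piMl.
Qed.

(** Continuity in the inputs at the fixed state [x] becomes joint continuity because the Lipschitz
    bound in the state is uniform in the inputs. The errors from the state, from the inputs of [f]
    and from the scaling factor take [e / 4] each. *)
Lemma aug_dyn_continuous (x : 'rV[R]_n) (w : 'rV[R]_m * R) (b : 'rV[R]_p) (e : R) : W w ->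
  V b -> 0 < e ->
  \forall z \near ((x, w), b), W z.1.2 -> V z.2 -> `|dyn z.1.1 z.1.2 z.2 - dyn x w b| < e.
Proof.
case: w => u c Ww Vb e0.
have [/= Uu] := Ww; rewrite in_itv /= => /andP[c0 c1].
have /subspace_continuousP /(_ (u,
  b) (conj Uu Vb)) /cvgrPdist_lt /(_ (e / 4) _) := @f_continuous x.
rewrite divr_gt0 // => /(_ isT).
rewrite near_withinE => /nbhs_ballP [d /= d0 df].
pose r := Num.min d (Num.min (e / 4 / L) (e / 4 / (C + 1))).
have C10 : 0 < C + 1 by rewrite ltr_wpDl.
have r0 : 0 < r by rewrite !lt_min d0 !divr_gt0.
apply/nbhs_ballP; exists r => // -[[y [u' c']] b'] /= [[yx [uu' cc']] bb'] Ww' Vb'.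
have [/= Uu'] := Ww'; rewrite in_itv /= => /andP[c'0 c'1].
have {}yx : `|x - y| <= e / 4 / L.
  by move: yx; rewrite -ball_normE /= => /ltW yx; apply: (le_trans yx);
    rewrite !ge_min lexx orbT.
have {}cc' : `|c - c'| <= e / 4 / (C + 1).
  by move: cc' => /ltW cc'; apply: (le_trans cc'); rewrite !ge_min lexx !orbT.
have h1 : `|f x u b - f x u' b'| < e / 4.
  apply: (df (u', b')) => //; split => /=.
    by apply: le_ball uu'; rewrite ge_min lexx.
  by apply: le_ball bb'; rewrite ge_min lexx.
rewrite /aug_dyn /=.
have -> : c' *: f y u' b' - c *: f x u b =
  c' *: (f y u' b' - f x u' b') - c' *: (f x u b - f x u' b') - (c - c') *: f x u b.
  by apply/rowP => i; rewrite !mxE; ring.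
have a1 : `|c' *: (f y u' b' - f x u' b')| <= e / 4.
  rewrite normrZ (ger0_norm c'0); apply: (@le_trans _ _ `|f y u' b' - f x u' b'|);
    first by rewrite ler_piMl.
  apply: (le_trans (f_lipschitz _ _ Uu' Vb')); rewrite distrC mulrC -ler_pdivlMr //.
have a2 : `|c' *: (f x u b - f x u' b')| <= e / 4.
  by rewrite normrZ (ger0_norm c'0); apply: le_trans (ltW h1); rewrite ler_piMl.
have a3 : `|(c - c') *: f x u b| <= e / 4.
  rewrite normrZ; have fC : `|f x u b| <= C + 1 by have := f_bounded x Uu Vb; lra.
  apply: (le_trans (ler_pM _ _ cc' fC)) => //.
  by rewrite divfK // gt_eqF.
have b1 := ler_normB (c' *: (f y u' b' - f x u' b') - c' *: (f x u b - f x u' b')) ((c - c')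
  *: f x u b).
have b2 := ler_normB (c' *: (f y u' b' - f x u' b')) (c' *: (f x u b - f x u' b')).
by lra.
Qed.

Definition admissible (a b : R) (u : R -> 'rV[R]_m * R) (v : R -> 'rV[R]_p) :=
  controls W a b u /\ controls V a b v.

Lemma aug_dyn_measurable a b u v phi : admissible a b u v ->
  (forall s s', a <= s -> s <= s' -> s' <= b -> `|phi s' - phi s| <= C * (s' - s)) ->
  forall i (G : set R), open G ->
  lebesgue_set ([set` `[a, b]] `&` (fun s => dyn (phi s) (u s) (v s) 0 i) @^-1` G).
Proof.
move=> [[Wu mu] [Vv mv]] lphi i.
have mI : lebesgue_set [set` `[a, b]] by exact: lebesgue_set_itv.
move/(lebesgue_measurable_funP _ mI) : mu => mu.
move/(lebesgue_measurable_funP _ mI) : mv => mv.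
have mphi G : open G -> lebesgue_set ([set` `[a, b]] `&` phi @^-1` G).
  have := @lebesgue_set_comp R R [set` `[a, b]] [set` `[a, b]] id _ phi (fun _ => id).
  apply; last by move=> G' oG'; apply: lebesgue_setI => //; apply: lebesgue_set_borel;
    exact: measurable_realfun.open_measurable.
  move=> x; rewrite /= in_itv /= => /andP[ax xb] e e0.
  have C10 : 0 < C + 1 by rewrite ltr_wpDl.
  apply/nbhs_ballP; exists (e / (C + 1)); first by rewrite /= divr_gt0.
  move=> y /=; rewrite in_itv /= /ball /= ltr_pdivlMr // => xy /andP[ay yb].
  apply: le_lt_trans xy.
  have [yx|xy] := leP y x.
    rewrite distrC; apply: (le_trans (lphi _ _ ay yx xb)).
    by rewrite mulrC ger0_norm ?subr_ge0 // ler_wpM2l ?subr_ge0 // lerDl.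
  apply: (le_trans (lphi _ _ ax (ltW xy) yb)).
  by rewrite mulrC distrC ger0_norm ?subr_ge0 ?(ltW xy) // ler_wpM2l ?subr_ge0 ?(ltW xy) //
    lerDl.
pose X := ('rV[R]_n * ('rV[R]_m * R) * 'rV[R]_p)%type.
have := @lebesgue_set_comp R X [set z | W z.1.2 /\ V z.2] [set` `[a, b]]
   (fun s => ((phi s, u s), v s)) R (fun z => dyn z.1.1 z.1.2 z.2 0 i).
apply.
- by move=> s /=; rewrite in_itv /= => sab; split; [exact: Wu|exact: Vv].
- move=> [[x w] b'] [/= Ww Vb] e e0; have := aug_dyn_continuous x Ww Vb e0.
  apply: filterS => z zP [Wz Vz]; apply: le_lt_trans (zP Wz Vz).
  by have := ler_coord_norm (dyn z.1.1 z.1.2 z.2 - dyn x w b') i; rewrite !mxE.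
- apply: lebesgue_set_pair => //.
  + apply: separable_prod; first exact: separable_rV.
    by apply: separable_prod; [exact: separable_rV|exact: separable_R].
  + exact: separable_rV.
  + apply: lebesgue_set_pair => //; first exact: separable_rV.
    by apply: separable_prod; [exact: separable_rV|exact: separable_R].
Qed.
Lemma flowP t x u v : t <= T -> admissible t T u v ->
  aug_trajectory f T t x u v (fun s => flow s t x u v).
Proof.
move=> tT adm; have [[Wu _] [Vv _]] := adm.
have [|||phi [phit lphi [ac d]]] := @caratheodory_existence R n t T C L x
    (fun s y => dyn y (u s) (v s)) tT C0 L0.
- by move=> s y sab; apply: aug_dyn_bounded; [exact: Wu|exact: Vv].
- by move=> s y z sab; apply: aug_dyn_lipschitz; [exact: Wu|exact: Vv].
- by move=> phi lphi i G oG; exact: aug_dyn_measurable adm lphi i G oG.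
by apply: (@xgetPex _ (fun=> 0) (aug_trajectory f T t x u v)); exists phi; split.
Qed.

Lemma flow_start t x u v : t <= T -> admissible t T u v -> flow t t x u v = x.
Proof. by move=> tT adm; have [] := flowP x tT adm. Qed.

Lemma flow_solves t x u v : t <= T -> admissible t T u v ->
  solves t T (fun s => dyn (flow s t x u v) (u s) (v s)) (fun s => flow s t x u v).
Proof. by move=> tT adm; have [] := flowP x tT adm. Qed.

Lemma flow_lip t x u v s s' : admissible t T u v -> t <= s -> s <= s' -> s' <= T ->
  `|flow s' t x u v - flow s t x u v| <= C * (s' - s).
Proof.
move=> adm ts ss' s'T; have tT : t <= T by lra.
apply: (solves_lip C0 (flow_solves x tT adm)) => //.
have [[Wu _] [Vv _]] := adm.
by apply: ae_all => r rab; apply: aug_dyn_bounded; [exact: Wu|exact: Vv].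
Qed.

(** The flows may start at different times; they are compared from [s0] on, where their inputs
    agree. With equal states at [s0] this is the uniqueness used to glue trajectories. *)
Lemma flow_dist t t' x x' u u' v v' s0 b : t <= s0 -> t' <= s0 -> b <= T ->
  admissible t T u v -> admissible t' T u' v' ->
  {ae lebesgue_measure, forall s : R, s0 <= s <= b -> u s = u' s} ->
  {ae lebesgue_measure, forall s : R, s0 <= s <= b -> v s = v' s} ->
  forall s, s0 <= s <= b -> `|flow s t x u v - flow s t' x' u' v'| <=
    2 * expR (2 * L * (b - s0)) * `|flow s0 t x u v - flow s0 t' x' u' v'|.
Proof.
move=> ts t's bT adm adm' uu' vv' s sab; have tT : t <= T by lra.
have t'T : t' <= T by lra.
have [[Wu _] [Vv _]] := adm.
have := @gronwall R n s0 b L (`|flow s0 t x u v - flow s0 t' x' u' v'| + 2 * C * (b - s0)) _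
  _ _ _ L0
  (solvesW ts bT (flow_solves x tT adm)) (solvesW t's bT (flow_solves x' t'T adm')).
apply => //.
- apply: aeS (ae_and uu' vv') => r [h1 h2] rab; rewrite -(h1 rab) -(h2 rab).
  by apply: aug_dyn_lipschitz; [apply: Wu|apply: Vv]; lra.
- move=> r /andP[s0r rb].
  have h1 := flow_lip x adm ts s0r (le_trans rb bT).
  have h2 := flow_lip x' adm' t's s0r (le_trans rb bT).
  rewrite (_ : flow r t x u v - _ = (flow r t x u v - flow s0 t x u v) -
    (flow r t' x' u' v' - flow s0 t' x' u' v') + (flow s0 t x u v - flow s0 t' x' u' v')).
    apply: (le_trans (ler_normD _ _)); rewrite addrC lerD2l.
    apply: (le_trans (ler_normB _ _)).
    have : C * (r - s0) <= C * (b - s0) by rewrite ler_wpM2l // lerD2r.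
    lra.
  by apply/rowP => i; rewrite !mxE; ring.
Qed.

Lemma flow_agree t t' x x' u u' v v' s0 b : t <= s0 -> t' <= s0 -> b <= T ->
  admissible t T u v -> admissible t' T u' v' ->
  {ae lebesgue_measure, forall s : R, s0 <= s <= b -> u s = u' s} ->
  {ae lebesgue_measure, forall s : R, s0 <= s <= b -> v s = v' s} ->
  flow s0 t x u v = flow s0 t' x' u' v' ->
  forall s, s0 <= s <= b -> flow s t x u v = flow s t' x' u' v'.
Proof.
move=> ts t's bT adm adm' uu' vv' e s sab.
have := flow_dist x x' ts t's bT adm adm' uu' vv' sab.
by rewrite e subrr normr0 mulr0 normr_le0 subr_eq0 => /eqP.
Qed.

(** * Payoff and value *)

Local Notation J := (payoff f l h T).

Lemma payoff_leP t x u v c : t <= T ->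
  J t x u v <= c <-> l (flow T t x u v) <= c /\ forall s, t <= s <= T ->
    h (flow s t x u v) <= c.
Proof.
move=> tT; rewrite /payoff ge_max; set S := [set h _ | _ in _].
have S0 : S !=set0 by exists (h (flow t t x u v)), t => //=; rewrite in_itv /= lexx.
have hS : has_sup S by split => //; exists B => _ [s _ <-];
  have := h_bounded (flow s t x u v); rewrite ler_norml => /andP[].
split=> [/andP[-> Sc]|[-> hc]].
  split => // s sab; apply: le_trans Sc; apply: ub_le_sup hS.2 _ _; exists s => //=;
    by rewrite in_itv.
by apply: ge_sup => // _ [s + <-]; rewrite /= in_itv /= => /hc.
Qed.

Lemma payoff_bounded t x u v : t <= T -> `|J t x u v| <= B.
Proof.
move=> tT; rewrite ler_norml; apply/andP; split; last first.
  apply/payoff_leP => //; split=> [|s _].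
    by have := l_bounded (flow T t x u v); rewrite ler_norml => /andP[].
  by have := h_bounded (flow s t x u v); rewrite ler_norml => /andP[].
by rewrite /payoff le_max; have := l_bounded (flow T t x u v); rewrite ler_norml => /andP[->].
Qed.

Local Notation Vt t := (controls V t T).
Local Notation Gam := (aug_strategies U V T).
Local Notation val := (value U V f l h T).

Lemma controls_nonempty (t : R) : exists v, Vt t v.
Proof. by have [b Vb] := V_neq0; exists (fun=> b); exact: controls_cst. Qed.

Lemma strategies_nonempty t : exists gamma, Gam t gamma.
Proof.
have [u Uu] := U_neq0; exists (fun _ _ => (u, 0)); split.
  by move=> v _; apply: controls_cst; split => //=; rewrite in_itv /= lexx ler01.
by move=> s v v' *; apply: ae_all.
Qed.

Let sups t x gamma := [set J t x (gamma v) v | v in Vt t].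

Let has_sup_sups t x gamma : t <= T -> has_sup (sups t x gamma).
Proof.
move=> tT; have [v Vv] := controls_nonempty t; split; first by exists (J t x (gamma v) v), v.
by exists B => _ [w _ <-]; have := payoff_bounded x (gamma w) w tT; rewrite ler_norml =>
  /andP[].
Qed.

Let has_inf_sups t x : t <= T -> has_inf [set sup (sups t x gamma) | gamma in Gam t].
Proof.
move=> tT; have [g Gg] := strategies_nonempty t; split; first by exists (sup (sups t x g)), g.
exists (- B) => _ [g' _ <-]; have [v Vv] := controls_nonempty t.
apply: (@le_trans _ _ (J t x (g' v) v)).
  by have := payoff_bounded x (g' v) v tT; rewrite ler_norml => /andP[].
by apply: ub_le_sup (has_sup_sups x g' tT).2 _ _; exists v.
Qed.

(** This and the next three lemmas are the only access to [value] below, so nonemptiness and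
    boundedness for [sup] and [inf] are settled here. *)
Lemma value_le t x c gamma : t <= T -> Gam t gamma ->
  (forall v, Vt t v -> J t x (gamma v) v <= c) -> val (x, t) <= c.
Proof.
move=> tT Gg Jc; rewrite /value /=.
apply: (@le_trans _ _ (sup (sups t x gamma))).
  by apply: ge_inf (has_inf_sups x tT).2 _ _; exists gamma.
by apply: ge_sup (has_sup_sups x gamma tT).1 _ => _ [v Vv <-]; exact: Jc.
Qed.

Lemma value_ge t x c : t <= T ->
  (forall gamma, Gam t gamma -> exists2 v, Vt t v & c <= J t x (gamma v) v) -> c <= val (x, t).
Proof.
move=> tT Jc; rewrite /value /=.
apply: lb_le_inf (has_inf_sups x tT).1 _ => _ [g Gg <-].
have [v Vv cJ] := Jc g Gg; apply: (le_trans cJ).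
by apply: ub_le_sup (has_sup_sups x g tT).2 _ _; exists v.
Qed.

Lemma value_lt t x c : t <= T -> val (x, t) < c ->
  exists2 gamma, Gam t gamma & forall v, Vt t v -> J t x (gamma v) v <= c.
Proof.
move=> tT; rewrite -subr_gt0 => e0; have [_ [g Gg <-]] := inf_adherent e0 (has_inf_sups x tT).
rewrite /value /= addrC subrK => lt; exists g => // v Vv.
by apply: le_trans (ltW lt); apply: ub_le_sup (has_sup_sups x g tT).2 _ _; exists v.
Qed.

Lemma value_gt t x c gamma : t <= T -> Gam t gamma -> c < val (x, t) ->
  exists2 v, Vt t v & c < J t x (gamma v) v.
Proof.
move=> tT Gg clt; apply: contrapT => H; have : val (x, t) <= c.
  apply: (value_le tT Gg) => v Vv; rewrite leNgt; apply/negP => lt; by apply: H; exists v.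
by rewrite leNgt clt.
Qed.

(** * Dynamic programming *)

Lemma strategy_admissible t gamma v : Gam t gamma -> Vt t v -> admissible t T (gamma v) v.
Proof. by move=> [Gc _] Vv; split => //; exact: Gc. Qed.

(** The minimizing player follows [gamma] up to [s] and then a strategy that is [e]-optimal for the
    state reached. *)
Lemma dpp_le t s x c gamma : t <= s -> s <= T -> Gam t gamma ->
  (forall v, Vt t v -> (forall r, t <= r <= s -> h (flow r t x (gamma v) v) <= c) /\
    val (flow s t x (gamma v) v, s) <= c) ->
  val (x, t) <= c.
Proof.
move=> ts sT Gg hc; apply/ler_addgt0Pr => e e0.
have tT : t <= T by lra.
(* One continuation for every state; where the value is not below [c + e], an arbitrary strategy
   fills in and is never played. *)
have [G GP] : exists G : 'rV[R]_n -> (R -> 'rV[R]_p) -> R -> 'rV[R]_m * R,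
    forall y, Gam s (G y) /\ (val (y, s) < c + e -> forall v, Vt s v ->
      J s y (G y v) v <= c + e).
  have := @choice _ _ (fun y g => Gam s g /\ (val (y, s) < c + e -> forall v, Vt s v ->
    J s y (g v) v <= c + e)).
  case=> [y|G GP]; last by exists G.
  have [lt|nlt] := pselect (val (y, s) < c + e).
    by have [g Gg' Jg] := value_lt sT lt; exists g.
  by have [g Gg'] := strategies_nonempty s; exists g.
pose y v := flow s t x (gamma v) v.
pose g' v := concat s (gamma v) (G (y v) v).
have Vs v : Vt t v -> Vt s v by exact: controlsW.
have cg' v : Vt t v -> controls W t T (g' v).
  move=> Vv; apply: controls_concat => //.
    by apply: controlsW (Gg.1 v Vv).
  by have [[Gc _] _] := GP (y v); apply: Gc; exact: Vs.
have Gg' : Gam t g'.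
  split => // r v v' /andP[tr rT] Vv Vv' vv'.
  have [rs|sr] := ltP r s.
    apply: aeS (Gg.2 r v v' _ Vv Vv' vv') => [q hq /andP[tq qr]|]; last by lra.
    rewrite /g' /concat (le_lt_trans qr rs).
    by apply: hq; lra.
  have vs : {ae lebesgue_measure, forall q : R, t <= q <= s -> v q = v' q}.
    by apply: aeS vv' => q hq ?; apply: hq; lra.
  have us := Gg.2 s v v' (introT andP (conj ts sT)) Vv Vv' vs.
  (* Controls that agree beyond [s] have led to the same state, hence select the same continuation,
     whose own nonanticipation applies. *)
  have ye : y v = y v'.
    apply: (@flow_agree t t x x _ _ _ _ t s) => //; try exact: strategy_admissible.
    - by rewrite !flow_start //; exact: strategy_admissible.
    - by lra.
  have [[_ Gn] _] := GP (y v).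
  have vr : {ae lebesgue_measure, forall q : R, s <= q <= r -> v q = v' q}.
    by apply: aeS vv' => q hq ?; apply: hq; lra.
  have := Gn r v v' (introT andP (conj sr rT)) (Vs _ Vv) (Vs _ Vv') vr.
  move=> ur; apply: aeS (ae_and us ur) => q [h1 h2] /andP[tq qr].
  rewrite /g' /concat -ye; case: ltP => qs; [apply: h1|apply: h2]; lra.
apply: (value_le tT Gg') => v Vv.
have [hv vv] := hc v Vv.
have vlt : val (y v, s) < c + e by apply: (le_lt_trans vv); lra.
have [Gy /(_ vlt v (Vs _ Vv)) Jy] := GP (y v).
have adm' : admissible t T (g' v) v by split => //; exact: cg'.
have adm := strategy_admissible Gg Vv.
have admy := strategy_admissible Gy (Vs _ Vv).
have flow1 r : t <= r <= s -> flow r t x (g' v) v = flow r t x (gamma v) v.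
  apply: (@flow_agree t t x x _ _ _ _ t s) => //.
  - exact: ae_concat_left.
  - exact: ae_all.
  - by rewrite !flow_start.
have flow2 r : s <= r <= T -> flow r t x (g' v) v = flow r s (y v) (G (y v) v) v.
  apply: (@flow_agree t s _ _ _ _ _ _ s T) => //.
  - by apply: ae_all => q /andP[sq _]; rewrite /g' concat_right.
  - exact: ae_all.
  - by rewrite flow1 ?lexx ?ts // flow_start.
move: Jy => /(payoff_leP _ _ _ _ sT) [ly hy]; apply/payoff_leP => //; split.
  by rewrite flow2 ?sT ?lexx.
move=> r /andP[tr rT]; have [rs|sr] := leP r s.
  by rewrite flow1 ?tr //; apply: (le_trans (hv r _)); [rewrite tr|lra].
by rewrite flow2 ?rT ?andbT ?(ltW sr) //; apply: hy; rewrite rT ltW.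
Qed.

(** The running cost on [[t, s]] can only raise the payoff, so the lower bound ignores it. *)
Lemma dpp_ge t s x c : t <= s -> s <= T ->
  (forall gamma, Gam t gamma -> exists2 v, Vt t v & c <= val (flow s t x (gamma v) v, s)) ->
  c <= val (x, t).
Proof.
move=> ts sT hc; apply/ler_addgt0Pl => e e0; rewrite -lerBlDl.
have tT : t <= T by lra.
apply: value_ge => // g Gg; have [v1 V1 cv1] := hc g Gg.
set y := flow s t x (g v1) v1 in cv1.
have Vc v : Vt s v -> Vt t (concat s v1 v).
  by move=> Vv; apply: controls_concat => //; exact: controlsW V1.
(* Once the past [v1] is fixed, [g] induces a strategy on [[s, T]]. Nonanticipation keeps the state
   at [s] equal to [y] whatever is played later. *)
pose g2 v := g (concat s v1 v).
have Gg2 : Gam s g2.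
  split=> [v Vv|r v v' /andP[sr rT] Vv Vv' vv'].
    by apply: controlsW (Gg.1 _ (Vc _ Vv)).
  apply: aeS (Gg.2 r _ _ _ (Vc _ Vv) (Vc _ Vv') _) => [q hq /andP[sq qr]||].
  - by apply: hq; lra.
  - by lra.
  - by apply: aeS vv' => q hq /andP[tq qr]; rewrite /concat; case: ltP => // sq; apply: hq; lra.
have vlt : c - e < val (y, s) by apply: lt_le_trans cv1; lra.
have [v2 V2 Jv2] := value_gt sT Gg2 vlt.
exists (concat s v1 v2); first exact: Vc.
have adm := strategy_admissible Gg (Vc _ V2).
have adm1 := strategy_admissible Gg V1.
have adm2 := strategy_admissible Gg2 V2.
have ys : flow s t x (g (concat s v1 v2)) (concat s v1 v2) = y.
  apply: (@flow_agree t t x x _ _ _ _ t s) => //.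
  - by apply: (Gg.2 s) => //; [rewrite ts|exact: Vc|exact: ae_concat_left].
  - exact: ae_concat_left.
  - by rewrite !flow_start.
  - by rewrite ts lexx.
have flow2 r : s <= r <= T -> flow r t x (g (concat s v1 v2)) (concat s v1 v2) = flow r s y
  (g2 v2) v2.
  apply: (@flow_agree t s _ _ _ _ _ _ s T) => //.
  - exact: ae_all.
  - by apply: ae_all => q /andP[sq _]; rewrite concat_right.
  - by rewrite ys flow_start.
apply: le_trans (ltW Jv2) _; apply/payoff_leP => //.
have [lJ hJ] := (payoff_leP x (g (concat s v1 v2)) (concat s v1 v2) _ tT).1 (lexx _).
by split=> [|r /andP[sr rT]]; [rewrite -flow2 ?sT ?lexx|rewrite -flow2 ?sr //; apply: hJ; lra].
Qed.

(** * Boundary values and regularity of the value *)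

Lemma h_le_value t x : t <= T -> h x <= val (x, t).
Proof.
move=> tT; apply: value_ge => // g Gg; have [v Vv] := controls_nonempty t; exists v => //.
have [_] := (payoff_leP x (g v) v _ tT).1 (lexx _).
move=> /(_ t); rewrite flow_start //; last exact: strategy_admissible.
by apply; rewrite lexx.
Qed.

Lemma value_terminal x : val (x, T) = Num.max (l x) (h x).
Proof.
have JT g v : Gam T g -> Vt T v -> flow T T x (g v) v = x.
  by move=> Gg Vv; apply: flow_start => //; exact: strategy_admissible.
apply/eqP; rewrite eq_le; apply/andP; split.
  have [g Gg] := strategies_nonempty T; apply: (value_le _ Gg) => // v Vv.
  apply/payoff_leP => //; split=> [|s]; first by rewrite JT // le_max lexx.
  by rewrite -eq_le => /eqP <-; rewrite JT // le_max lexx orbT.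
rewrite ge_max h_le_value // andbT; apply: value_ge => // g Gg.
have [v Vv] := controls_nonempty T; exists v => //.
by have [+ _] := (payoff_leP x (g v) v _ (lexx T)).1 (lexx _); rewrite JT.
Qed.

(** The Lipschitz constant of the costs times the Gronwall factor over the whole horizon. *)
Definition value_modulus := K * (2 * expR (2 * L * T)).

Lemma value_modulus_ge : 0 <= T -> K <= value_modulus.
Proof.
move=> T0; rewrite /value_modulus ler_peMr //.
suff : 1 <= expR (2 * L * T) by lra.
by rewrite -expR0 ler_expR !mulr_ge0 // ltW.
Qed.

Lemma value_modulus_ge0 : 0 <= value_modulus.
Proof. by rewrite /value_modulus !mulr_ge0 // expR_ge0. Qed.

Lemma value_lipschitz_x t x y : 0 <= t -> t <= T ->
  val (x, t) <= val (y, t) + value_modulus * `|x - y|.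
Proof.
move=> t0 tT; apply/ler_addgt0Pr => e e0.
have lt : val (y, t) < val (y, t) + e by lra.
have [g Gg Jg] := value_lt tT lt.
apply: (value_le tT Gg) => v Vv; have adm := strategy_admissible Gg Vv.
have [lJ hJ] := (payoff_leP y (g v) v _ tT).1 (Jg v Vv).
have D s : t <= s <= T -> K * `|flow s t x (g v) v - flow s t y (g v) v| <= value_modulus *
  `|x - y|.
  move=> sab; rewrite -mulrA; apply: ler_wpM2l => //.
  have := @flow_dist t t x y _ _ _ _ t T (lexx t) (lexx t) (lexx T) adm adm
    (ae_all (fun _ _ => erefl)) (ae_all (fun _ _ => erefl)) s sab.
  rewrite !flow_start // => H; apply: (le_trans H); apply: ler_wpM2r => //.
  by apply: ler_wpM2l => //; rewrite ler_expR ler_wpM2l ?gerBl // mulr_ge0 // ltW.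
apply/payoff_leP => //; split=> [|s sab].
  have TT : t <= T <= T by rewrite tT lexx.
  have := l_lipschitz (flow T t x (g v) v) (flow T t y (g v) v); have := D T TT.
  rewrite ler_norml; lra.
have := h_lipschitz (flow s t x (g v) v) (flow s t y (g v) v); have := D s sab.
have := hJ s sab; rewrite ler_norml; lra.
Qed.

(** Any control and any strategy will do, since the state moves by at most [C * (s - t)]. In the
    upper bound the running cost on [[t, s]] is absorbed by [h x <= val (x, s)]. *)
Lemma value_lipschitz_t x t s : 0 <= t -> t <= s -> s <= T ->
  `|val (x, t) - val (x, s)| <= value_modulus * C * (s - t).
Proof.
move=> t0 ts sT; have T0 : 0 <= T by lra.
have tT : t <= T by lra.
have s0 : 0 <= s by lra.
have Ks := value_modulus_ge T0.
have mv g v r : Gam t g -> Vt t v -> t <= r <= s -> `|flow r t x (g v) v - x| <= C * (s - t).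
  move=> Gg Vv /andP[tr rs]; have adm := strategy_admissible Gg Vv.
  have := flow_lip x adm (lexx t) tr (le_trans rs sT); rewrite flow_start // => H.
  by apply: (le_trans H); rewrite ler_wpM2l // lerD2r.
have st0 : 0 <= C * (s - t) by rewrite mulr_ge0 // subr_ge0.
have M0 := value_modulus_ge0.
rewrite ler_norml; apply/andP; split.
  rewrite lerBrDl; apply: (dpp_ge ts sT) => g Gg; have [v Vv] := controls_nonempty t.
  exists v => //; have := value_lipschitz_x x (flow s t x (g v) v) s0 sT.
  rewrite distrC; have : s - s = 0 by ring.
  have := ler_wpM2l M0 (mv g v s Gg Vv _); rewrite ts lexx => /(_ isT); lra.
rewrite lerBlDl; have [g Gg] := strategies_nonempty t.
apply: (dpp_le ts sT Gg) => v Vv; split=> [r rs|].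
  have := h_lipschitz (flow r t x (g v) v) x; rewrite ler_norml => /andP[_].
  have := ler_wpM2l K0 (mv g v r Gg Vv rs); have := h_le_value x sT.
  have : K * (C * (s - t)) <= value_modulus * (C * (s - t)) by rewrite ler_wpM2r.
  lra.
have := value_lipschitz_x (flow s t x (g v) v) x s0 sT.
have := ler_wpM2l M0 (mv g v s Gg Vv _); rewrite ts lexx => /(_ isT); lra.
Qed.

Lemma value_continuous : 0 <= T -> {within [set z | 0 <= z.2 <= T], continuous val}.
Proof.
move=> T0; apply/subspace_continuousP => -[x t] /= tT; apply/cvgrPdist_lt => e e0.
rewrite near_withinE.
pose M := value_modulus * (C + 1) + 1.
have M0 : 0 < M by rewrite ltr_wpDl // mulr_ge0 ?value_modulus_ge0 ?addr_ge0.
apply/nbhs_ballP; exists (e / M); first by rewrite /= divr_gt0.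
move=> [y s] [/= xy ts] sT.
move: xy; rewrite -ball_normE /= => xy; move: ts; rewrite /ball /= => ts.
have h1 : `|val (x, t) - val (y, t)| <= value_modulus * `|x - y|.
  have /andP[t0 t1] := tT; have := value_lipschitz_x x y t0 t1.
  have := value_lipschitz_x y x t0 t1; rewrite (distrC y) ler_norml; lra.
have h2 : `|val (y, t) - val (y, s)| <= value_modulus * C * `|t - s|.
  have [st|lt_ts] := leP s t.
    rewrite distrC (ger0_norm (_ : 0 <= t - s)) ?subr_ge0 //; apply: value_lipschitz_t => //;
      lra.
  by rewrite (distrC t) (gtr0_norm (_ : 0 < s - t)) ?subr_gt0 //; apply: value_lipschitz_t; lra.
have := ler_distD (val (y, t)) (val (x, t)) (val (y, s)).
have d0 : 0 < e / M by rewrite divr_gt0.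
have Md : M * (e / M) = e by rewrite mulrC divfK // gt_eqF.
move: d0 Md xy ts; rewrite {2}/M; set d := e / M => d0 Md xy ts.
have a1 : value_modulus * `|x - y| <= value_modulus * d.
  by apply: ler_wpM2l (ltW xy); exact: value_modulus_ge0.
have a2 : value_modulus * C * `|t - s| <= value_modulus * C * d.
  by apply: ler_wpM2l (ltW ts); rewrite mulr_ge0 // value_modulus_ge0.
lra.
Qed.

(** * Viscosity inequalities for the value *)

Lemma dot_flow_le t x u v q c d : admissible t T u v -> 0 <= d -> t + d <= T ->
  (forall s, t <= s <= t + d -> dot q (dyn (flow s t x u v) (u s) (v s)) <= c) ->
  dot q (flow (t + d) t x u v - x) <= c * d.
Proof.
move=> adm d0 tdT qc; have tT : t <= T by lra.
have ttd : t <= t + d by lra.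
have [ac dphi] := solvesW (lexx t) tdT (flow_solves x tT adm).
have := @abs_continuous_derive_le R t (t + d) (fun s => dot q (flow s t x u v)) (fun s =>
  c * s) (fun=> c) ttd.
rewrite dotBr flow_start // -mulrBr (_ : t + d - t = d); last by ring.
apply.
- apply: (@abs_continuous_dom _ _ _ _ t (t + d) (\sum_i `|q 0 i|) _ (fun=> 0 : R) _ _ ac).
    by move=> s s' _ _ _; rewrite -dotBr subrr normr0 addr0 dot_norm_le.
  by apply: (@abs_continuous_lip _ _ _ _ 0) => *; rewrite subrr normr0 mul0r.
- apply: (@abs_continuous_lip _ _ _ _ `|c|) => s s' _ ss' _.
  by rewrite -mulrBr normrM (ger0_norm (_ : 0 <= s' - s)) ?subr_ge0.
- move=> s; have := @is_deriveZ R R R id c s 1 _ (is_derive_id s 1).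
  by rewrite /GRing.scale /= mulr1.
- apply: aeS dphi => s D sab; exists (dot q (dyn (flow s t x u v) (u s) (v s))); last exact: qc.
  have Di i : is_derive s 1 (fun r => q 0 i * flow r t x u v 0 i : R)
      (q 0 i * dyn (flow s t x u v) (u s) (v s) 0 i).
    exact: (@is_deriveZ R R R (fun r =>
      flow r t x u v 0 i) _ s 1 _ (is_derive_coord i (D sab))).
  have := is_derive_sum Di; congr (is_derive _ _ _ _).
  by apply/funext => r; rewrite fct_sumE.
Qed.

(** The threshold [d0] is fixed before the inputs, so one time step serves against every control or
    strategy of the opponent. [P] transports the local extremality to the endpoint. *)
Lemma flow_expansion x t (g : 'rV[R]_n * R -> R) (P : set ('rV[R]_n * R)) (e : R) :
  0 < t < T -> smooth_on [set z | 0 < z.2 < T] g -> 0 < e -> nbhs (x, t) P ->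
  exists2 d0 : R, 0 < d0 & forall d, 0 < d < d0 -> t + d <= T /\
    forall u v, admissible t T u v ->
    [/\ `|g (flow (t + d) t x u v, t + d) - g (x, t) -
          (partial_t g (x, t) * d + dot (partial_x g (x,
            t)) (flow (t + d) t x u v - x))| <= e * d,
        P (flow (t + d) t x u v, t + d),
        forall s, t <= s <= t + d -> `|flow s t x u v - x| <= C * d &
        forall s, t <= s <= t + d ->
          `|dot (partial_x g (x, t)) (dyn (flow s t x u v) (u s) (v s)) -
            dot (partial_x g (x, t)) (dyn x (u s) (v s))| <= e].
Proof.
move=> /andP[t0 tT] smg e0 Pxt.
have oO : open [set z : 'rV[R]_n * R | 0 < z.2 < T].
  rewrite (_ : mkset _ = snd @^-1` [set` `]0, T[]).
    by apply: open_comp; [move=> z _; exact: cvg_snd|exact: interval_open].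
  by apply/seteqP; split => z /=; rewrite in_itv.
(* In time [d] the l1 displacement in time and space is at most [(1 + n * C) * d]. *)
pose e' := e / (1 + n%:R * C).
have nC0 : 0 < 1 + n%:R * C by rewrite ltr_pwDl // mulr_ge0.
have e'0 : 0 < e' by rewrite divr_gt0.
have tTT : 0 < t < T by rewrite t0.
have := smooth_on_expansion oO (tTT : [set z : 'rV[R]_n * R | 0 < z.2 < T] (x, t)) smg e'0.
move=> /(filterI Pxt) /nbhs_ballP [r /= r0 rP].
set q := partial_x g (x, t).
pose A := (\sum_i `|q 0 i|) * L * C + 1.
have A0 : 0 < A.
  by rewrite ltr_wpDl // mulr_ge0 // mulr_ge0 ?(ltW L0) // sumr_ge0.
have C10 : 0 < C + 1 by rewrite ltr_wpDl.
exists (Num.min (T - t) (Num.min (r / (C + 1)) (e / A))).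
  by rewrite !lt_min subr_gt0 tT !divr_gt0.
move=> d /andP[d0]; rewrite !lt_min => /and3P[dT]; rewrite !ltr_pdivlMr // => dr dA.
have tdT : t + d <= T by lra.
split => // u v adm.
have near s : t <= s <= t + d -> `|flow s t x u v - x| <= C * d.
  move=> /andP[ts sd]; have := flow_lip x adm (lexx t) ts (le_trans sd tdT).
  rewrite flow_start // ?(ltW tT) // => le; apply: (le_trans le); apply: ler_wpM2l => //; lra.
have std : t <= t + d <= t + d by lra.
have Cd : C * d < r by move: dr; have := d0; lra.
have [|/= Pd Wd] := rP (flow (t + d) t x u v, t + d).
  split; first by rewrite -ball_normE /= distrC; exact: le_lt_trans (near _ std) Cd.
  rewrite /ball /= opprD addNKr normrN gtr0_norm //.
  by have : 0 <= C * d by [rewrite mulr_ge0 // ltW]; lra.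
split => //.
- move: Wd; rewrite (_ : t + d - t = d); last by ring.
  move=> Wd; apply: (le_trans Wd).
  have -> : e * d = e' * (d + n%:R * C * d) by rewrite /e'; field; rewrite gt_eqF.
  rewrite (gtr0_norm d0); apply: ler_wpM2l; first exact: ltW.
  rewrite lerD2l -mulrA mulr_natl.
  have -> : (C * d) *+ n = \sum_(i < n) C * d by rewrite sumr_const card_ord.
  apply: ler_sum => i _; apply: le_trans (near _ std).
  by have := ler_coord_norm (flow (t + d) t x u v - x) i; rewrite !mxE.
- move=> s sd; have [[Wu _] [Vv _]] := adm; rewrite -dotBr.
  apply: (le_trans (dot_norm_le _ _)).
  apply: (@le_trans _ _ ((\sum_i `|q 0 i|) * (L * (C * d)))).
    apply: ler_wpM2l; first by rewrite sumr_ge0.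
    have sT : t <= s <= T by lra.
    apply: (le_trans (aug_dyn_lipschitz _ _ (Wu _ sT) (Vv _ sT))).
    by apply: ler_wpM2l; [exact: ltW|exact: near].
  have : d * A = (\sum_i `|q 0 i|) * (L * (C * d)) + d by rewrite /A; ring.
  by move: dA d0; lra.
Qed.
Local Notation H := (hamiltonian U V f).

(** If the expression were negative, the feedback would make the test function, and hence the value,
    drop by a definite multiple of [d], while [h] stays below the value on the short interval;
    [dpp_le] then gives [val (x, t) < val (x, t)]. *)
Lemma value_subsolution x t g : 0 < t < T -> smooth_on [set z | 0 < z.2 < T] g ->
  local_max (val \- g) (x, t) -> 0 <= vi_expr U V f h val g (x, t).
Proof.
move=> tT smg lmax; rewrite leNgt; apply/negP; rewrite /vi_expr gt_max /= => /andP[hv Hlt].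
have /andP[t0 tT'] := tT.
set a := partial_t g (x, t) in Hlt; set q := partial_x g (x, t) in Hlt.
(* The margin is spent in thirds: choosing [w] for a given [v], keeping it for nearby [v'], and
   absorbing the expansion errors. *)
pose th := - (a + Num.min 0 (H x q)) / 3.
have th0 : 0 < th by rewrite divr_gt0 // oppr_gt0.
have th3 : Num.min 0 (H x q) = - a - 3 * th by rewrite /th; field.
clearbody th.
have [|v Vv|sigma [sP sc]] := @measurable_selection R 'rV[R]_p ('rV[R]_m * R)%type V W
    (fun w b => dot q (dyn x w b) <= - a - th) (separable_rV R p) _ _.
- have [u Uu] := U_neq0; exists (u, 0); split => //=; rewrite in_itv /=; lra.
- have [w Ww qw] : exists2 w, W w & dot q (dyn x w v) < - a - 2 * th.
    (* If the Hamiltonian is nonnegative the player freezes the state with factor 0; otherwise it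
       moves at full speed with factor 1. *)
    have [Hx|Hx] := leP 0 (H x q).
      have [u Uu] := U_neq0; exists (u, 0); first by split => //=; rewrite in_itv /=; lra.
      rewrite /aug_dyn /= dotZr mul0r; by move: th3; rewrite min_l //; lra.
    have Hx' : H x q < - a - 2 * th by move: th3; rewrite min_r ?(ltW Hx) // => ->; lra.
    have [u Uu qu] := hamiltonian_lt U_neq0 V_neq0 f_bounded Hx' Vv; exists (u, 1);
      first by split => //=; rewrite in_itv /=; lra.
    by rewrite /aug_dyn /= scale1r.
  exists w => //.
  pose N1 := (\sum_i `|q 0 i|) + 1.
  have N10 : 0 < N1 by rewrite ltr_wpDl // sumr_ge0.
  have := aug_dyn_continuous x Ww Vv (divr_gt0 th0 N10).
  move=> /nbhs_ballP [r /= r0 rP]; apply/nbhs_ballP; exists r => // v' vv' Vv'.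
  have bz : ball ((x, w), v) r ((x, w), v') by split => //; split; exact: ballxx.
  have /= := rP _ bz; move=> /(_ Ww Vv').
  rewrite ltr_pdivlMr // => lt.
  have := dot_norm_le q (dyn x w v' - dyn x w v); rewrite dotBr ler_norml => /andP[_].
  have : (\sum_i `|q 0 i|) * `|dyn x w v' - dyn x w v| <= `|dyn x w v' - dyn x w v| * N1.
    by rewrite mulrC ler_wpM2l // lerDl.
  lra.
have gap : 0 < val (x, t) - h x by lra.
have [d0 d00 dP] := flow_expansion tT smg (divr_gt0 th0 (ltr0Sn R 3)) lmax.
have KC0 : 0 < K * C + th by rewrite ltr_wpDl // mulr_ge0.
(* The second bound keeps [h] at most [val (x, t) - th * d] along the trajectory. *)
pose d := Num.min (d0 / 2) ((val (x, t) - h x) / (K * C + th)).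
have dgt0 : 0 < d by rewrite lt_min !divr_gt0.
have [|tdT {}dP] := dP d.
  by rewrite dgt0 /d gt_min; apply/orP; left; lra.
have dgap : d * (K * C + th) <= val (x, t) - h x by rewrite -ler_pdivlMr // /d ge_min lexx orbT.
have Gs : Gam t (fun v => sigma \o v).
  split=> [v Vv|s v v' _ _ _]; first exact: sc.
  by apply: aeS => r hr rs /=; rewrite hr.
have thd : 0 < th * d by rewrite mulr_gt0.
suff : val (x, t) <= val (x, t) - th / 4 * d by lra.
have ttd : t <= t + d by lra.
apply: (dpp_le ttd tdT Gs) => v Vv.
have adm := strategy_admissible Gs Vv.
have [e1 e2 e3 e4] := dP _ _ adm.
split=> [r rs|].
  have := h_lipschitz (flow r t x (sigma \o v) v) x; rewrite ler_norml => /andP[_].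
  have := ler_wpM2l K0 (e3 r rs); move: dgap.
  have : 0 < th * d by rewrite mulr_gt0.
  lra.
have : dot q (flow (t + d) t x (sigma \o v) v - x) <= (- a - th + th / 4) * d.
  apply: (dot_flow_le adm (ltW dgt0) tdT) => s sd; have := e4 s sd.
  have sT : t <= s <= T by lra.
  rewrite ler_norml => /andP[_]; have [_] := sP (v s) (Vv.1 s sT).
  rewrite -/q /=; lra.
move: e1; rewrite -/a -/q ler_norml => /andP[_].
move: e2 => /=; set z := (flow _ _ _ _ _, _); have : 0 < th * d by rewrite mulr_gt0.
lra.
Qed.

Lemma value_supersolution x t g : 0 < t < T -> smooth_on [set z | 0 < z.2 < T] g ->
  local_min (val \- g) (x, t) -> vi_expr U V f h val g (x, t) <= 0.
Proof.
move=> tT smg lmin; have /andP[t0 tT'] := tT.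
rewrite /vi_expr ge_max subr_le0 /= h_le_value ?(ltW tT') //= leNgt; apply/negP.
set a := partial_t g (x, t); set q := partial_x g (x, t) => Hgt.
pose th := (a + Num.min 0 (H x q)) / 3.
have th0 : 0 < th by rewrite divr_gt0.
have th3 : Num.min 0 (H x q) = 3 * th - a by rewrite /th; field.
clearbody th.
have ath : 2 * th < a.
  have : Num.min 0 (H x q) <= 0 by rewrite ge_min lexx.
  by rewrite th3; lra.
have [v0 Vv0 qv0] : exists2 v, V v & forall u, U u -> - a + 2 * th < dot q (f x u v).
  apply: (hamiltonian_gt U_neq0 V_neq0 f_bounded);
    have : Num.min 0 (H x q) <= H x q by rewrite ge_min lexx orbT.
  by rewrite th3; lra.
(* Slowing down moves the product towards 0, and 0 itself exceeds [- a + 2 * th] by [ath]. *)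
have qw w : W w -> - a + 2 * th <= dot q (dyn x w v0).
  case: w => u c [/= Uu]; rewrite in_itv /= => /andP[c0 c1]; rewrite /aug_dyn /= dotZr.
  have := qv0 u Uu; have [q0|q0] := leP 0 (dot q (f x u v0)).
    by have := mulr_ge0 c0 q0; lra.
  have : 0 <= (1 - c) * - dot q (f x u v0) by rewrite mulr_ge0 //; lra.
  by rewrite mulrBl mul1r mulrN; lra.
have [d0 d00 dP] := flow_expansion tT smg (divr_gt0 th0 (ltr0Sn R 1)) lmin.
have [|tdT {}dP] := dP (d0 / 2); first by lra.
set d := d0 / 2 in tdT dP.
have dgt0 : 0 < d by rewrite divr_gt0.
have thd : 0 < th * d by rewrite mulr_gt0.
suff : val (x, t) + th / 4 * d <= val (x, t) by lra.
have ttd : t <= t + d by lra.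
apply: (dpp_ge ttd tdT) => gam Gg; exists (fun=> v0); first exact: controls_cst.
have Vc : Vt t (fun=> v0) by exact: controls_cst.
have adm := strategy_admissible Gg Vc.
have [e1 e2 e3 e4] := dP _ _ adm.
(* [dot_flow_le] bounds from above, hence the opposite momentum. *)
have : dot (- q) (flow (t + d) t x (gam (fun=> v0)) (fun=> v0) - x) <= (a - 2 * th + th / 2)
  * d.
  apply: (dot_flow_le adm (ltW dgt0) tdT) => s sd; have := e4 s sd.
  have sT : t <= s <= T by lra.
  rewrite ler_norml dotNl => /andP[+ _]; have := qw _ (adm.1.1 s sT); rewrite -/q /=.
  lra.
rewrite dotNl; move: e1; rewrite -/a -/q ler_norml => /andP[+ _].
move: e2 => /=; set z := (flow _ _ _ _ _, _); have : 0 < th * d by rewrite mulr_gt0.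
lra.
Qed.

End game.

(** * Euclidean and sup norms, and the conclusion *)

Section enorm.
Context {R : realType} {n : nat}.
Implicit Types x : 'rV[R]_n.

Lemma norm_le_enorm x : `|x| <= enorm x.
Proof.
apply: rV_norm_le => [|i]; first exact: sqrtr_ge0.
rewrite -sqrtr_sqr ler_wsqrtr // (bigD1 i) //= lerDl sumr_ge0 // => j _; exact: sqr_ge0.
Qed.

(** The crude factor [n.+1%:R] remains positive in dimension 0, as the positivity of [L]
    requires. *)
Lemma enorm_le_norm x : enorm x <= n.+1%:R * `|x|.
Proof.
have nx0 : 0 <= n.+1%:R * `|x| by rewrite mulr_ge0.
rewrite -[leRHS](ger0_norm nx0) -sqrtr_sqr ler_wsqrtr //.
apply: (@le_trans _ _ (\sum_(i < n) `|x| ^+ 2)).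
  apply: ler_sum => i _; rewrite -(real_normK (num_real (x 0 i))).
  by rewrite ler_pXn2r ?nnegrE // ler_coord_norm.
rewrite sumr_const card_ord exprMn -[_ *+ n]mulr_natl ler_wpM2r ?sqr_ge0 // -natrX ler_nat.
by rewrite (leq_trans (leqnSn n)) // leq_pmulr.
Qed.

End enorm.

Theorem theorem2 (R : realType) (n m p : nat) (T : R)
    (U : set 'rV[R]_m) (V : set 'rV[R]_p)
    (f : 'rV[R]_n -> 'rV[R]_m -> 'rV[R]_p -> 'rV[R]_n)
    (l h : 'rV[R]_n -> R) (Cf Cl Ch : R)
    (T_ge0 : 0 <= T)
    (U_neq0 : U !=set0) (U_compact : compact U)
    (V_neq0 : V !=set0) (V_compact : compact V)
    (Cf_gt0 : 0 < Cf) (Cl_gt0 : 0 < Cl) (Ch_gt0 : 0 < Ch)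
    (f_bounded : forall x u v, U u -> V v -> enorm (f x u v) <= Cf)
    (f_lipschitz : forall x y u v, U u -> V v ->
      enorm (f x u v - f y u v) <= Cf * enorm (x - y))
    (f_continuous : forall x,
      {within U `*` V, continuous (fun w => f x w.1 w.2)})
    (l_bounded : forall x, `|l x| <= Cl)
    (l_lipschitz : forall x y, `|l x - l y| <= Cl * enorm (x - y))
    (h_bounded : forall x, `|h x| <= Ch)
    (h_lipschitz : forall x y, `|h x - h y| <= Ch * enorm (x - y)) :
  viscosity_solution U V f l h T (value U V f l h T) /\
  (forall F : 'rV[R]_n * R -> R, viscosity_solution U V f l h T F ->
    forall x t, 0 <= t <= T -> F (x, t) = value U V f l h T (x, t)).
Proof.
(* The constants are converted to the sup norm; [Cl + Ch] serves both costs, as a bound and, after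
   conversion, as a Lipschitz constant. *)
pose L := Cf * n.+1%:R; pose K := (Cl + Ch) * n.+1%:R.
have C0 : 0 <= Cf by exact: ltW.
have L0 : 0 < L by rewrite mulr_gt0.
have K0 : 0 <= K by rewrite mulr_ge0 // addr_ge0 // ltW.
have fb x u v : U u -> V v -> `|f x u v| <= Cf.
  by move=> Uu Vv; apply: le_trans (norm_le_enorm _) (f_bounded x u v Uu Vv).
have fl x y u v : U u -> V v -> `|f x u v - f y u v| <= L * `|x - y|.
  move=> Uu Vv; apply: le_trans (norm_le_enorm _) _.
  apply: le_trans (f_lipschitz x y u v Uu Vv) _.
  by rewrite -mulrA ler_pM2l // enorm_le_norm.
have lb x : `|l x| <= Cl + Ch by apply: le_trans (l_bounded x) _; rewrite lerDl ltW.
have hb x : `|h x| <= Cl + Ch by apply: le_trans (h_bounded x) _; rewrite lerDr ltW.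
have lip (c : R) (x y : 'rV[R]_n) : 0 < c -> c <= Cl + Ch -> c * enorm (x - y) <= K * `|x - y|.
  move=> c0 cC; have e0 : 0 <= enorm (x - y) by exact: sqrtr_ge0.
  apply: le_trans (ler_wpM2r e0 cC) _.
  have CC : 0 <= Cl + Ch by exact: le_trans (ltW c0) cC.
  by rewrite -[leRHS]mulrA; exact: ler_wpM2l CC _ _ (enorm_le_norm _).
have ll x y : `|l x - l y| <= K * `|x - y|.
  by apply: le_trans (l_lipschitz x y) _; apply: lip => //; rewrite lerDl ltW.
have hl x y : `|h x - h y| <= K * `|x - y|.
  by apply: le_trans (h_lipschitz x y) _; apply: lip => //; rewrite lerDr ltW.
have sol : viscosity_solution U V f l h T (value U V f l h T).
  split.
  - exact: (@value_continuous R n m p U V f l h T Cf L (Cl + Ch) K).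
  - exact: (@value_terminal R n m p U V f l h T Cf L (Cl + Ch)).
  - move=> [x t] W tT smW; split.
      exact: (@value_subsolution R n m p U V f l h T Cf L (Cl + Ch) K).
    exact: (@value_supersolution R n m p U V f l h T Cf L (Cl + Ch)).
split => // F [cF FT Fvisc] x t tT.
have [cV VT Vvisc] := sol.
have cmp := @comparison R n m p U V f h T Cf L K U_neq0 V_neq0 C0 L0 K0 fb fl hl.
apply/eqP; rewrite eq_le; apply/andP; split.
  apply: cmp => //.
  - by move=> z W zT sW; apply: (Fvisc z W zT sW).1.
  - by move=> z W zT sW; apply: (Vvisc z W zT sW).2.
  - by move=> y; rewrite FT VT.
apply: cmp => //.
- by move=> z W zT sW; apply: (Vvisc z W zT sW).1.
- by move=> z W zT sW; apply: (Fvisc z W zT sW).2.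
- by move=> y; rewrite FT VT.
Qed.
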